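(* Let $k>1$ be an odd integer, let $s$ be any positive even integer, and let $\sigma_k>0$ be any Weyl-admissible exponent for $k$. Then for every $\epsilon>0$ there is a constant $C>0$, depending only on $k,s,\epsilon$ (and the fixed choice of $\sigma_k$), such that for every $N\in\mathbb{N}$ and every set $A\subset\{1,\dots,N\}$ satisfying $(A-A)\cap\mathcal{A}_{k,s}=\emptyset$, one has $$|A|\le C\,N^{1-\sigma_k/k+\epsilon}.$$
   Context: $\mathbb{N}$ denotes the positive integers, $e(x)=e^{2\pi i x}$, and $A-A=\{x-y: x,y\in A\}$. Define $\mathcal{A}_{k,s}=\{a_1^k+\cdots+a_s^k:\ a_1,\dots,a_s\in\mathbb{N}\}$. A real number $\sigma_k>0$ is called Weyl-admissible for $k$ if for every $\delta>0$ there is a constant $C_{k,\delta}$ such that $$\Big|\sum_{1\le m\le X} e(\alpha m^k)\Big|\le C_{k,\delta}\,X^{1+\delta}\left(\frac1q+\frac1X+\frac{q}{X^{k}}\right)^{\sigma_k}$$ for all real $X>0$ and all $\alpha\in\mathbb{R}$, $a\in\mathbb{Z}$, $q\in\mathbb{N}$ with $\gcd(a,q)=1$ and $|\alpha-a/q|\le q^{-2}$. *)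

(* Defs.v *)
From mathcomp Require Import all_boot all_order all_algebra.
From mathcomp Require Import finmap.
From mathcomp Require Import complex.
From mathcomp Require Import all_classical all_reals all_analysis.

Set Implicit Arguments.
Unset Strict Implicit.
Unset Printing Implicit Defensive.

Import Order.TTheory GRing.Theory Num.Theory.

Local Open Scope classical_set_scope.
Local Open Scope ring_scope.

(* e(x) = exp(2 pi i x), given by Euler's formula: the library has no complex
   exponential. *)
Definition expe (R : realType) (x : R) : R[i] :=
  Complex (cos (2 * pi * x)) (sin (2 * pi * x)).

(* For X >= 0, [Num.truncn X] is the floor of X, so m ranges over 1 <= m <= X. *)
Definition weyl_sum (R : realType) (k : nat) (alpha X : R) : R[i] :=
  \sum_(1 <= m < (Num.truncn X).+1) expe (alpha * m%:R ^+ k).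

(* [ComplexField.Normc.normc] is the complex modulus with values in R, whereas
   the generic norm on R[i] takes its values in R[i]. *)
Definition weyl_admissible (R : realType) (k : nat) (sigma : R) : Prop :=
  0 < sigma /\
  forall delta : R, 0 < delta ->
  exists C : R, forall (X alpha : R) (a : int) (q : nat),
    0 < X -> (0 < q)%N -> coprimez a q%:Z ->
    `|alpha - a%:~R / q%:R| <= q%:R ^- 2 ->
    ComplexField.Normc.normc (weyl_sum k alpha X) <=
      C * X `^ (1 + delta) *
      (q%:R^-1 + X^-1 + q%:R / X ^+ k) `^ sigma.

Definition power_sums (k s : nat) : set int :=
  [set (\sum_(i < s) a i ^ k)%N%:Z
     | a in [set a : 'I_s -> nat | forall i, (0 < a i)%N]].

Definition difference_set (A : {fset nat}) : set int :=
  [set x%:Z - y%:Z | x in [set` A] & y in [set` A]].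

(* Main.v *)
Require Import Defs.
From mathcomp Require Import all_boot all_order all_algebra.
From mathcomp Require Import finmap.
From mathcomp Require Import complex.
From mathcomp Require Import all_classical all_reals all_analysis.
From mathcomp Require Import ring lra zify.
Import Defs.

(** Put [X = N ^ (1 / k)] and let [S_Y(alpha)] be the mean of [e(alpha m ^ k)]
  over [1 <= m <= Y] against a smooth weight ([smooth_sum]). The trigonometric
  polynomial [T(alpha) = \sum_(u < N) (N - u) S_Y(alpha) ^ s], where
  [Y = u ^ (1 / k)] ([vdc_poly]), has nonnegative coefficients, and its
  frequencies are sums of [s] positive [k]-th powers of size at most [s N]. If
  no such sum is a difference of elements of [A], then, with [M = (s + 1) N] and
  [hatA] the exponential sum of [A], orthogonality gives
  [\sum_(r < M) |hatA(r / M)| ^ 2 T(r / M) = 0]. The term [r = 0] is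
  [|A| ^ 2 T(0)], so a lower bound [Re T >= - E] yields [|A| T(0) <= E M]
  ([vdc_set_bound]). As [T(0)] has order [N ^ 2] ([vdc_poly0]), everything comes
  down to [E = N ^ (2 - sigma / k + eps)] ([vdc_poly_lower]).

  Write [alpha = a / q + beta] by Dirichlet's theorem. Near a rational point
  [S_Y(alpha)] is close to [V I(beta u)], where [V] is the mean of
  [e(a m ^ k / q)] over a period and [I(x)] is the integral of
  [w(t) e(x t ^ k)]. Since [k] is odd, [m -> - m] conjugates the complete sum,
  so [V] is real; since [s] is even, [V ^ s >= 0] ([gauss_mean_real]). Moreover
  [I(x) ^ s] is a positive combination of characters [e(x tau)], so that
  averaging [I(beta u) ^ s] over [u] with the weights [N - u] produces Fejer
  kernels and the real part of the result is at least [- N / 2]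
  ([grid_integral_fejer]). The main term of [T] is thus harmless on all arcs.

  The approximation by [V I(beta u)] is needed with the relative error
  [X ^ (- sigma + eps)] ([local_approx]). When [q < Y ^ (1 - e)] it follows from
  [J]-fold summation by parts with [J >= 1 / e] ([smooth_sum_major]); this is
  why the weight is smooth. Otherwise [S_Y(alpha)] and [V] are both small by the
  Weyl bound ([smooth_sum_minor], [gauss_mean_minor]), and the share [u / N] of
  the scale [Y] in [T] pays for its being shorter than [X].

  To avoid a comparison of sums with integrals, [I] is taken to be a Riemann sum
  on a fine mesh and the scales [Y] are rational numbers whose common numerator
  is the number of mesh points ([grid_integral], [scale]): the smooth sum is
  then a sum over the same mesh, weighted by a periodic function. *)

Set Implicit Arguments.
Unset Strict Implicit.
Unset Printing Implicit Defensive.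

Import Order.TTheory GRing.Theory Num.Theory.
Import numFieldNormedType.Exports.

Local Open Scope classical_set_scope.
Local Open Scope ring_scope.
Local Open Scope complex_scope.

(** * The complex modulus and the additive characters *)

Local Notation cabs := ComplexField.Normc.normc.

Section ComplexModulus.
Variable R : realType.
Implicit Types (x y : R) (z t : R[i]).

Lemma cabs_ge0 z : 0 <= cabs z.
Proof. by case: z => a b; exact: sqrtr_ge0. Qed.

Lemma cabsD z t : cabs (z + t) <= cabs z + cabs t.
Proof. exact: complex.le_normcD. Qed.

Lemma cabsN z : cabs (- z) = cabs z.
Proof. exact: complex.normcN. Qed.

Lemma cabsM z t : cabs (z * t) = cabs z * cabs t.
Proof. exact: ComplexField.Normc.normcM. Qed.

Lemma cabs0 : cabs (0 : R[i]) = 0.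
Proof. exact: ComplexField.Normc.normc0. Qed.

Lemma cabs1 : cabs (1 : R[i]) = 1.
Proof. exact: ComplexField.Normc.normc1. Qed.

Lemma cabsX z n : cabs (z ^+ n) = cabs z ^+ n.
Proof.
by elim: n => [|n IH]; [rewrite !expr0 cabs1 | rewrite !exprS cabsM IH].
Qed.

Lemma cabsB z t : cabs (z - t) <= cabs z + cabs t.
Proof. by rewrite -(cabsN t); exact: cabsD. Qed.

Lemma cabs_real x : cabs (x%:C) = `|x|.
Proof. by rewrite /ComplexField.Normc.normc /= expr0n addr0 sqrtr_sqr. Qed.

Lemma cabs_sum (I : Type) (r : seq I) (P : pred I) (F : I -> R[i]) :
  cabs (\sum_(i <- r | P i) F i) <= \sum_(i <- r | P i) cabs (F i).
Proof.
elim/big_ind2: _ => [|z x t y zx ty|//]; first by rewrite cabs0.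
exact: le_trans (cabsD _ _) (lerD zx ty).
Qed.

Lemma ler_Re_cabs z : `|complex.Re z| <= cabs z.
Proof.
case: z => a b /=; rewrite -sqrtr_sqr ler_wsqrtr// lerDl; exact: sqr_ge0.
Qed.

Lemma Re_add z t : complex.Re (z + t) = complex.Re z + complex.Re t.
Proof. by case: z t => [a b] [c d]. Qed.

Lemma Re_sum (I : Type) (r : seq I) (P : pred I) (F : I -> R[i]) :
  complex.Re (\sum_(i <- r | P i) F i) = \sum_(i <- r | P i) complex.Re (F i).
Proof.
by elim/big_rec2: _ => [//|i z t _ <-]; rewrite Re_add.
Qed.

Lemma Re_realM x z : complex.Re (x%:C * z) = x * complex.Re z.
Proof. by case: z => a b /=; rewrite mul0r subr0. Qed.

Lemma cabs_subX z t n : cabs z <= 1 -> cabs t <= 1 ->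
  cabs (z ^+ n - t ^+ n) <= n%:R * cabs (z - t).
Proof.
move=> z1 t1; elim: n => [|n IH]; first by rewrite !expr0 subrr cabs0 mul0r.
have -> : z ^+ n.+1 - t ^+ n.+1 = z * (z ^+ n - t ^+ n) + (z - t) * t ^+ n.
  by rewrite !exprS; ring.
rewrite -natr1 [leRHS]mulrDl mul1r; apply: le_trans (cabsD _ _) _.
rewrite !cabsM cabsX; apply: lerD.
  by apply: le_trans IH; rewrite ler_piMl ?cabs_ge0.
by rewrite ler_piMr ?cabs_ge0// exprn_ile1 ?cabs_ge0.
Qed.

End ComplexModulus.

Section Characters.
Variable R : realType.
Implicit Types (x y : R) (z t : R[i]).

Lemma expeD x y : expe (x + y) = expe x * expe y.
Proof.
by rewrite /expe mulrDr cosD sinD; congr Complex; rewrite addrC.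
Qed.

Lemma expe0 : expe (0 : R) = 1.
Proof. by rewrite /expe mulr0 cos0 sin0. Qed.

Lemma cabs_expe x : cabs (expe x) = 1.
Proof. by rewrite /expe /= cos2Dsin2 sqrtr1. Qed.

Lemma expe_conj x : expe (- x) = (expe x)^*%C.
Proof. by rewrite /expe mulrN cosN sinN. Qed.

Lemma expe_nat n : expe (n%:R : R) = 1.
Proof.
elim: n => [|n IH]; first by rewrite expe0.
rewrite -natr1 expeD IH mul1r /expe mulr1 mulrC -[pi * 2]/(pi * 2%:R) mulr_natr.
by rewrite cos2pi sin2pi.
Qed.

Lemma expe_int (n : int) : expe (n%:~R : R) = 1.
Proof.
case: n => n; first exact: expe_nat.
by rewrite NegzE mulrNz expe_conj expe_nat conjc1.
Qed.

Lemma expeMn x n : expe (x *+ n) = expe x ^+ n.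
Proof.
by elim: n => [|n IH]; rewrite ?mulr0n ?expe0// mulrS exprS expeD IH.
Qed.

Lemma sin_le_norm x : `|sin x| <= `|x|.
Proof.
have H y : 0 <= y -> `|sin y| <= y.
  move=> y0.
  have sin_cont : {within `[0, y], continuous (@sin R)}.
    by apply: continuous_subspaceT => z; exact: continuous_sin.
  have [c _ E] :=
    @MVT_segment R sin cos 0 y y0 (fun x _ => is_derive_sin x) sin_cont.
  move: E; rewrite sin0 !subr0 => ->.
  by rewrite normrM (ger0_norm y0) ler_piMl// cos_max.
have [x0|x0] := leP 0 x; first by rewrite (ger0_norm x0); exact: H.
by rewrite (ltr0_norm x0) -[sin x]opprK -sinN normrN H// oppr_ge0 ltW.
Qed.

Lemma cos_double x : cos (2 * x) = 1 - 2 * sin x ^+ 2.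
Proof.
rewrite mulrC -[2]/(2%:R) mulr_natr cos_mulr2n cos2sin2; ring.
Qed.

Lemma cabs_expe_sub1 x : cabs (expe x - 1) <= 2 * pi * `|x|.
Proof.
have -> : cabs (expe x - 1) = 2 * `|sin (pi * x)|.
  rewrite /expe /ComplexField.Normc.normc /= subr0 -[RHS]ger0_norm ?mulr_ge0//.
  rewrite -[RHS]sqrtr_sqr exprMn real_normK ?num_real//; congr Num.sqrt.
  have := cos2Dsin2 (2 * pi * x); rewrite -mulrA cos_double => H.
  lra.
have -> : 2 * pi * `|x| = 2 * `|pi * x|.
  by rewrite normrM (ger0_norm (pi_ge0 R)) mulrA.
by rewrite ler_pM2l// sin_le_norm.
Qed.

Lemma cabs_expe_sub x y : cabs (expe x - expe y) <= 2 * pi * `|x - y|.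
Proof.
have -> : expe x - expe y = expe y * (expe (x - y) - 1).
  by rewrite mulrBr -expeD mulr1 (addrC y) subrK.
by rewrite cabsM cabs_expe mul1r cabs_expe_sub1.
Qed.

Lemma expe_neq1 x : 0 < x < 1 -> expe x != 1.
Proof.
move=> /andP[x0 x1]; apply/eqP => /(congr1 (@complex.Re R)) /=.
rewrite -mulrA cos_double => H.
have : 0 < sin (pi * x).
  apply: sin_gt0_pi; rewrite mulr_gt0 ?pi_gt0//=.
  by rewrite -[ltRHS]mulr1 ltr_pM2l ?pi_gt0.
by move=> /(exprn_gt0 2); lra.
Qed.

Lemma expe_orthogonality (M : nat) (h : int) : (0 < M)%N -> ~~ (M%:Z %| h)%Z ->
  \sum_(0 <= r < M) expe (r%:R / M%:R * h%:~R : R) = 0.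
Proof.
move=> M0 Mh; have M0' : (0 : R) < M%:R by rewrite ltr0n.
pose z : R[i] := expe (h%:~R / M%:R).
have zE r : expe (r%:R / M%:R * h%:~R : R) = z ^+ r.
  by rewrite -expeMn; congr expe; rewrite -mulr_natl; field; rewrite gt_eqF.
have z1 : z != 1.
  pose d := (h %% M%:Z)%Z.
  have -> : z = expe (d%:~R / M%:R).
    rewrite /z {1}(divz_eq h M%:Z) rmorphD rmorphM /= mulrDl expeD.
    by rewrite -mulrA divff ?gt_eqF// mulr1 expe_int mul1r.
  apply: expe_neq1; rewrite divr_gt0 ?ltr_pdivrMr ?mul1r//=; last first.
    rewrite ltr0z lt_def modz_ge0 ?eqz_nat -?lt0n// andbT.
    by apply: contra Mh => /eqP d0; exact/dvdz_mod0P.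
  by rewrite -[M%:R]/((M%:Z)%:~R) ltr_int ltz_pmod.
have zM : z ^+ M = 1.
  rewrite -expeMn -[_ *+ M]mulr_natr divfK ?gt_eqF//; exact: expe_int.
have : (z - 1) * \sum_(r < M) z ^+ r = 0 by rewrite -subrX1 zM subrr.
move/eqP; rewrite mulf_eq0 subr_eq0 (negbTE z1) => /eqP sum0.
rewrite -[RHS]sum0.
by rewrite big_mkord; apply: eq_bigr => i _.
Qed.

End Characters.

(** * Finite differences *)

Definition fdiff (V : zmodType) (f : nat -> V) : nat -> V :=
  fun l => f l.+1 - f l.

Section FiniteDifferences.
Variables (R : realType) (V : pzRingType) (nm : V -> R).
Hypothesis nmD : forall x y, nm (x + y) <= nm x + nm y.
Hypothesis nmM : forall x y, nm (x * y) <= nm x * nm y.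
Hypothesis nm0 : nm 0 = 0.
Hypothesis nm_ge0 : forall x, 0 <= nm x.
Implicit Types (f g : nat -> V) (C rho : R) (n L j l : nat).

(** The differences of [f] up to order [n] decay like powers of [rho] on the
  window [0 .. L]; the window is there because the sequences of interest are
  polynomial weights, which grow outside it. *)
Definition slow n L C rho f := forall j l, (j <= n)%N -> (j + l <= L)%N ->
  nm (iter j (@fdiff V) f l) <= C * rho ^+ j.

Lemma iter_fdiffD j f g l :
  iter j (@fdiff V) (fun i => f i + g i) l =
  iter j (@fdiff V) f l + iter j (@fdiff V) g l.
Proof.
by elim: j l => [//|j IH] l; rewrite /= /fdiff !IH; rewrite opprD addrACA.
Qed.

Lemma iter_fdiffZ j c f l :
  iter j (@fdiff V) (fun i => c * f i) l = c * iter j (@fdiff V) f l.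
Proof. by elim: j l => [//|j IH] l; rewrite /= /fdiff !IH mulrBr. Qed.

Lemma iter_fdiff_shift j f l :
  iter j (@fdiff V) (fun i => f i.+1) l = iter j (@fdiff V) f l.+1.
Proof. by elim: j l => [//|j IH] l; rewrite /= /fdiff !IH. Qed.

Lemma fdiffM f g :
  fdiff (fun i => f i * g i) = fun l => fdiff f l * g l.+1 + f l * fdiff g l.
Proof.
apply/funext => l; rewrite /fdiff mulrBl mulrBr.
by rewrite addrA subrK.
Qed.

Lemma slow_le n n' L C C' rho f : 0 <= rho -> C <= C' -> (n' <= n)%N ->
  slow n L C rho f -> slow n' L C' rho f.
Proof.
move=> r0 CC nn H j l jn jl; apply: le_trans (H j l (leq_trans jn nn) jl) _.
by rewrite ler_wpM2r// exprn_ge0.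
Qed.

Lemma slow_fdiff n L C rho f : slow n.+1 L.+1 C rho f ->
  slow n L (C * rho) rho (fdiff f).
Proof.
move=> H j l jn jl; rewrite -iterSr -mulrA -exprS; exact: H.
Qed.

Lemma slow_shift n L C rho f : slow n L.+1 C rho f ->
  slow n L C rho (fun l => f l.+1).
Proof. by move=> H j l jn jl; rewrite iter_fdiff_shift; apply: H; lia. Qed.

Lemma slowW n L L' C rho f : (L' <= L)%N -> slow n L C rho f ->
  slow n L' C rho f.
Proof. by move=> LL H j l jn jl; apply: H => //; exact: leq_trans jl LL. Qed.

Lemma iter_fdiffM_le j L Cf Cg rho f g l : 0 <= rho -> 0 <= Cf -> 0 <= Cg ->
  slow j L Cf rho f -> slow j L Cg rho g -> (j + l <= L)%N ->
  nm (iter j (@fdiff V) (fun i => f i * g i) l) <=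
    2 ^+ j * Cf * Cg * rho ^+ j.
Proof.
move=> r0; elim: j L Cf Cg f g l => [|j IH] L Cf Cg f g l Cf0 Cg0 Hf Hg jl.
  rewrite expr0 mul1r mulr1 /=; apply: le_trans (nmM _ _) _.
  apply: ler_pM; rewrite ?nm_ge0//.
    by have := Hf 0%N l; rewrite mulr1; apply.
  by have := Hg 0%N l; rewrite mulr1; apply.
case: L Hf Hg jl => [|L] Hf Hg jl; first by rewrite addSn in jl.
rewrite iterSr fdiffM iter_fdiffD; apply: le_trans (nmD _ _) _.
have Hl : (j + l <= L)%N by rewrite addSn ltnS in jl.
have Hf' := slow_fdiff Hf; have Hg' := slow_fdiff Hg.
have jj : (j <= j.+1)%N by [].
have := IH L _ _ _ _ l (mulr_ge0 Cf0 r0) Cg0 Hf'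
  (slow_shift (slow_le r0 (lexx _) jj Hg)) Hl.
have := IH L _ _ _ _ l Cf0 (mulr_ge0 Cg0 r0)
  (slowW (leqnSn L) (slow_le r0 (lexx _) jj Hf)) Hg' Hl.
move=> H1 H2; apply: le_trans (lerD H2 H1) _.
by rewrite !exprS le_eqVlt; apply/orP; left; apply/eqP; ring.
Qed.

(** Leibniz: the product rule spreads [n] differences over the two factors, in
  at most [2 ^ n] ways. *)
Lemma slowM n L Cf Cg rho f g : 0 <= rho -> 0 <= Cf -> 0 <= Cg ->
  slow n L Cf rho f -> slow n L Cg rho g ->
  slow n L (2 ^+ n * Cf * Cg) rho (fun i => f i * g i).
Proof.
move=> r0 Cf0 Cg0 Hf Hg j l jn jl.
have le j' C h : slow n L C rho h -> (j' <= n)%N -> slow j' L C rho h.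
  by move=> H j'n; exact: slow_le H.
have leM := iter_fdiffM_le r0 Cf0 Cg0 (le _ _ _ Hf jn) (le _ _ _ Hg jn) jl.
apply: le_trans leM _.
rewrite -!mulrA ler_wpM2r ?mulr_ge0 ?exprn_ge0//.
by rewrite ler_weXn2l// ler1n.
Qed.

Lemma slow_cst n L rho c : 0 <= rho -> slow n L (nm c) rho (fun=> c).
Proof.
move=> r0 [|j] l jn jl; first by rewrite mulr1.
rewrite iterSr (_ : fdiff _ = fun=> 0); last first.
  by apply/funext => i; rewrite /fdiff subrr.
suff -> : iter j (@fdiff V) (fun=> 0) l = 0.
  by rewrite nm0 mulr_ge0 ?exprn_ge0 ?nm_ge0.
by elim: j l {jn jl} => [//|j IH] l; rewrite /= /fdiff !IH subrr.
Qed.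

Lemma iter_fdiff_le_sup j l f B : (forall i, nm (- i) = nm i) ->
  (forall i, (l <= i <= j + l)%N -> nm (f i) <= B) ->
  nm (iter j (@fdiff V) f l) <= 2 ^+ j * B.
Proof.
move=> nmN; elim: j l => [|j IH] l H.
  by rewrite expr0 mul1r /=; apply: H; lia.
rewrite /= /fdiff; apply: le_trans (nmD _ _) _; rewrite nmN exprS.
have := IH l.+1 (fun i Hi => H i ltac:(lia)).
have := IH l (fun i Hi => H i ltac:(lia)).
by lra.
Qed.

End FiniteDifferences.

Section SlowPhases.
Variable R : realType.
Implicit Types (psi phi : nat -> R) (rho tau A K : R) (n L : nat).

Local Notation slowR := (slow (fun x : R => `|x|)).
Local Notation slowC := (slow (@ComplexField.Normc.normc R)).

Lemma slowRM n L Cf Cg rho (f g : nat -> R) : 0 <= rho -> 0 <= Cf -> 0 <= Cg ->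
  slowR n L Cf rho f -> slowR n L Cg rho g ->
  slowR n L (2 ^+ n * Cf * Cg) rho (fun i => f i * g i).
Proof.
apply: slowM => //; [exact: ler_normD|by move=> x y; rewrite normrM].
Qed.

Lemma slowCM n L Cf Cg rho (f g : nat -> R[i]) :
  0 <= rho -> 0 <= Cf -> 0 <= Cg ->
  slowC n L Cf rho f -> slowC n L Cg rho g ->
  slowC n L (2 ^+ n * Cf * Cg) rho (fun i => f i * g i).
Proof.
by apply: slowM; [exact: cabsD|move=> x y; rewrite cabsM|exact: cabs_ge0].
Qed.

Lemma slowC_real n L C rho (f : nat -> R) : slowR n L C rho f ->
  slowC n L C rho (fun l => (f l)%:C).
Proof.
move=> H j l jn jl; suff -> : iter j (@fdiff R[i]) (fun l => (f l)%:C) l =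
  (iter j (@fdiff R) f l)%:C by rewrite cabs_real; exact: H.
elim: j l {jn jl} => [//|j IH] l; rewrite /= /fdiff !IH.
by rewrite -rmorphB.
Qed.

Lemma fdiff_expe phi :
  fdiff (fun l => expe (phi l)) =
  fun l => expe (phi l) * (expe (fdiff phi l) - 1).
Proof.
by apply/funext => l; rewrite /fdiff mulrBr mulr1 -expeD (addrC (phi l)) subrK.
Qed.

(** Since [Delta e(psi) = e(psi) (e(Delta psi) - 1)], the bound for [n + 1]
  differences of [e(psi) - 1] follows from the bound for [n] differences applied
  both to [psi] and to the smaller phase [Delta psi]. *)
Lemma slow_small_phase A n : 0 <= A -> exists2 K, 0 <= K &
  forall rho tau L psi, 0 <= rho <= 1 -> 0 <= tau <= 1 ->
  slowR n L (A * tau) rho psi ->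
  slowC n L (K * tau) rho (fun l => expe (psi l) - 1).
Proof.
move=> A0; elim: n => [|n [K K0 IH]].
  exists (2 * pi * A); first by rewrite !mulr_ge0// pi_ge0.
  move=> rho tau L psi rho01 tau01 H j l; rewrite leqn0 => /eqP -> jl.
  rewrite mulr1; apply: le_trans (cabs_expe_sub1 _) _.
  rewrite -(mulrA _ A) ler_wpM2l ?mulr_ge0 ?pi_ge0//.
  by have := H 0%N l (leqnn _) jl; rewrite mulr1.
have K1 : 0 <= 1 + K by rewrite addr_ge0.
have K'0 : 0 <= 2 ^+ n * (1 + K) * K by rewrite !mulr_ge0 ?exprn_ge0.
exists (K + 2 ^+ n * (1 + K) * K); first by rewrite addr_ge0.
move=> rho tau L psi /andP[r0 r1] /andP[t0 t1] H j l.
have r01 : 0 <= rho <= 1 by rewrite r0.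
have t01 : 0 <= tau <= 1 by rewrite t0.
have Hn : slowR n L (A * tau) rho psi by exact: slow_le H.
rewrite leq_eqVlt => /predU1P[-> jl|]; last first.
  rewrite ltnS => jn jl; apply: le_trans (IH _ _ _ _ r01 t01 Hn j l jn jl) _.
  by rewrite ler_wpM2r ?exprn_ge0// ler_wpM2r// lerDl.
case: L H Hn jl => [|L] H Hn jl; first by rewrite addSn in jl.
rewrite iterSr.
have -> : fdiff (fun l => expe (psi l) - 1) =
    fun l => expe (psi l) * (expe (fdiff psi l) - 1).
  rewrite -fdiff_expe; apply/funext => i; rewrite /fdiff; ring.
have tr01 : 0 <= tau * rho <= 1 by rewrite mulr_ge0// mulr_ile1.
have H2 : slowC n L (K * (tau * rho)) rho (fun l => expe (fdiff psi l) - 1).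
  by apply: IH => //; rewrite mulrA; exact: slow_fdiff.
have H1 : slowC n L (1 + K) rho (fun l => expe (psi l)).
  move=> i m ni im; have -> : (fun l => expe (psi l)) =
      (fun l => 1 + (expe (psi l) - 1)) :> (nat -> R[i]).
    by apply/funext => ?; rewrite addrC subrK.
  rewrite iter_fdiffD; apply: le_trans (cabsD _ _) _; rewrite mulrDl.
  apply: lerD.
    have := @slow_cst R _ (@ComplexField.Normc.normc R) (@cabs0 R) (@cabs_ge0 R)
      n L rho 1 r0 i m ni im.
    by rewrite cabs1.
  apply: le_trans (IH _ _ _ _ r01 t01 Hn i m ni (leqW im)) _.
  by rewrite ler_wpM2r ?exprn_ge0// ler_piMr.
have := slowCM r0 K1 (mulr_ge0 K0 (mulr_ge0 t0 r0)) H1 H2.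
move=> /(_ n l (leqnn n)); rewrite addSn ltnS in jl; move=> /(_ jl) HH.
apply: le_trans HH _.
have -> : 2 ^+ n * (1 + K) * (K * (tau * rho)) * rho ^+ n =
  2 ^+ n * (1 + K) * K * (tau * rho ^+ n.+1) by rewrite exprS; ring.
by rewrite -[leRHS]mulrA ler_wpM2r ?mulr_ge0 ?exprn_ge0// lerDr.
Qed.

(** A phase that is not small but has small differences: one difference of
  [e(phi)] brings in [e(Delta phi) - 1], to which the bound for small phases
  applies. *)
Lemma slow_phase A n : 0 <= A -> exists2 K, 0 <= K &
  forall rho L phi, 0 <= rho <= 1 ->
  (forall j l, (0 < j <= n)%N -> (j + l <= L)%N ->
     `|iter j (@fdiff R) phi l| <= A * rho ^+ j) ->
  slowC n L K rho (fun l => expe (phi l)).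
Proof.
move=> A0; elim: n => [|n [K K0 IH]].
  exists 1 => // rho L phi _ _ j l; rewrite leqn0 => /eqP -> _.
  by rewrite expr0 mulr1 [iter _ _ _ _]/= cabs_expe.
have [K' K'0 HK'] := slow_small_phase n A0.
exists (K + 2 ^+ n * K * K').
  by rewrite addr_ge0// !mulr_ge0 ?exprn_ge0.
move=> rho L phi /andP[r0 r1] H.
have r01 : 0 <= rho <= 1 by rewrite r0.
have Hn : slowC n L K rho (fun l => expe (phi l)).
  by apply: IH => // j l jn jl; apply: H => //; lia.
move=> j l; rewrite leq_eqVlt => /predU1P[-> jl|]; last first.
  rewrite ltnS => jn jl; apply: le_trans (Hn j l jn jl) _.
  by rewrite ler_wpM2r ?exprn_ge0// lerDl !mulr_ge0 ?exprn_ge0.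
case: L H Hn jl => [|L] H Hn jl; first by rewrite addSn in jl.
rewrite addSn ltnS in jl.
rewrite iterSr fdiff_expe.
have H2 : slowC n L (K' * rho) rho (fun l => expe (fdiff phi l) - 1).
  apply: HK' => // i m im iL; rewrite -iterSr -mulrA -exprS.
  by apply: H => //; lia.
have := slowCM r0 K0 (mulr_ge0 K'0 r0) (slowW (leqnSn L) Hn) H2.
move=> /(_ n l (leqnn n) jl) HH; apply: le_trans HH _.
have -> : 2 ^+ n * K * (K' * rho) * rho ^+ n =
  2 ^+ n * K * K' * rho ^+ n.+1 by rewrite exprS; ring.
by rewrite ler_wpM2r ?exprn_ge0// lerDr.
Qed.

End SlowPhases.

(** * Smooth weights and the local approximation *)

Section SmoothWeight.
Variable R : realType.
Implicit Types (t gamma rho K : R) (J k M : nat).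

Local Notation slowR := (slow (fun x : R => `|x|)).
Local Notation slowC := (slow (@ComplexField.Normc.normc R)).

(** The weight vanishes to order [J] at both ends of the unit interval, and
  being polynomial there it has no kink where differences could be large. *)
Definition bump J t : R := t ^+ J * (1 - t) ^+ J.

Definition bump_phase J k M gamma : nat -> R[i] :=
  fun l => (bump J (l%:R / M%:R))%:C * expe (gamma * (l%:R / M%:R) ^+ k).

Lemma slowRX n L C rho (f : nat -> R) k : 0 <= rho -> 0 <= C ->
  slowR n L C rho f -> slowR n L ((2 ^+ n * C) ^+ k) rho (fun l => f l ^+ k).
Proof.
move=> r0 C0 H; elim: k => [|k IH].
  rewrite expr0; have := @slow_cst R R (fun x => `|x|) (normr0 R) (@normr_ge0 R _)
    n L rho 1 r0; rewrite normr1.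
  by rewrite (_ : (fun l => f l ^+ 0) = fun=> 1)//; apply/funext => l; rewrite expr0.
have -> : (fun l => f l ^+ k.+1) = (fun l => f l * f l ^+ k).
  by apply/funext => l; rewrite exprS.
rewrite exprS; apply: slowRM => //.
by rewrite exprn_ge0// mulr_ge0 ?exprn_ge0.
Qed.

Lemma slow_grid n J M : (0 < M)%N ->
  slowR n (M + J) (1 + J%:R) M%:R^-1 (fun l => l%:R / M%:R).
Proof.
move=> M0; have M0' : 0 < M%:R :> R by rewrite ltr0n.
have M1 : 1 <= M%:R :> R by rewrite ler1n.
move=> [|j] l jn jl.
  rewrite mulr1 /= ger0_norm ?divr_ge0// ler_pdivrMr//.
  rewrite add0n in jl; apply: (@le_trans _ _ (M + J)%:R); rewrite ?ler_nat//.
  by rewrite natrD mulrDl mul1r lerD2l ler_peMr.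
rewrite iterSr.
have -> : fdiff (fun l => l%:R / M%:R : R) = fun=> M%:R^-1.
  by apply/funext => i; rewrite /fdiff -natr1 mulrDl mul1r addrC addKr.
have Mi0 : 0 <= M%:R^-1 :> R by rewrite invr_ge0 ltW.
have := @slow_cst R R (fun x => `|x|) (normr0 R) (@normr_ge0 R _) n (M + J)
   M%:R^-1 M%:R^-1 Mi0 j l (ltnW jn) (ltnW jl).
rewrite (ger0_norm Mi0) => H; apply: le_trans H _; rewrite exprS mulrA.
by rewrite ler_wpM2r ?exprn_ge0// ler_peMl// lerDl.
Qed.

Lemma slow_bump_phase J k : exists2 K, 0 <= K & forall M gamma, (0 < M)%N ->
  (1 + `|gamma|) / M%:R <= 1 ->
  slowC J (M + J) K ((1 + `|gamma|) / M%:R) (bump_phase J k M gamma).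
Proof.
pose D : R := 1 + J%:R; have D0 : 0 <= D by rewrite addr_ge0.
pose A : R := (2 ^+ J * D) ^+ k.
have A0 : 0 <= A by rewrite exprn_ge0// mulr_ge0// exprn_ge0.
have [K K0 HK] := slow_phase J A0.
pose D1 : R := 1 + D.
have D10 : 0 <= D1 by rewrite addr_ge0.
pose W : R := 2 ^+ J * (2 ^+ J * D) ^+ J * (2 ^+ J * D1) ^+ J.
have W0 : 0 <= W by rewrite !mulr_ge0// ?exprn_ge0// mulr_ge0// exprn_ge0.
exists (2 ^+ J * W * K).
  by apply: mulr_ge0 => //; apply: mulr_ge0 => //; exact: exprn_ge0.
move=> M gamma M0 r1; set rho := _ / _.
have M0' : 0 < M%:R :> R by rewrite ltr0n.
have Mi0 : 0 <= M%:R^-1 :> R by rewrite invr_ge0 ltW.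
have r0 : 0 <= rho by rewrite divr_ge0 ?addr_ge0// ltW.
have Mr : M%:R^-1 <= rho.
  by rewrite /rho ler_peMl// lerDl.
have grid := @slow_grid J J M M0.
have weaken n C (f : nat -> R) : 0 <= C -> slowR n (M + J) C M%:R^-1 f ->
    slowR n (M + J) C rho f.
  move=> C0 H j l jn jl; apply: le_trans (H j l jn jl) _.
  by rewrite ler_wpM2l// lerXn2r.
apply: slowCM => //.
  apply: slowC_real; apply: weaken => //; apply: slowRM => //.
  - by rewrite exprn_ge0// mulr_ge0// exprn_ge0.
  - by rewrite exprn_ge0// mulr_ge0// exprn_ge0.
  - exact: slowRX.
  apply: slowRX => //.
  move=> [|j] l jn jl.
    rewrite mulr1 /=; apply: le_trans (ler_normB _ _) _.
    rewrite normr1 lerD2l.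
    by have := grid 0%N l (leq0n _) jl; rewrite mulr1.
  have -> : iter j.+1 (@fdiff R) (fun i => 1 - i%:R / M%:R) l =
      - iter j.+1 (@fdiff R) (fun i => i%:R / M%:R) l.
    rewrite !iterSr -[RHS]mulN1r -iter_fdiffZ; congr (iter _ _ _ _).
    by apply/funext => i; rewrite /fdiff; ring.
  rewrite normrN; apply: le_trans (grid _ l jn jl) _.
  by rewrite ler_wpM2r ?exprn_ge0// lerDr.
apply: HK; first by rewrite r0.
move=> j l /andP[j0 jn] jl.
rewrite iter_fdiffZ normrM.
have := slowRX k Mi0 D0 grid jn jl => H.
apply: le_trans (ler_wpM2l (normr_ge0 _) H) _.
rewrite mulrCA ler_wpM2l// /rho expr_div_n -exprVn ler_wpM2r ?exprn_ge0//.
have g1 : 1 <= 1 + `|gamma| by rewrite lerDl.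
apply: (@le_trans _ _ (1 + `|gamma|)); first by rewrite lerDr.
by rewrite -{1}[1 + _]expr1 ler_weXn2l.
Qed.

Lemma bump_ge0 J t : 0 <= t <= 1 -> 0 <= bump J t.
Proof. by move=> /andP[t0 t1]; rewrite mulr_ge0// exprn_ge0// subr_ge0. Qed.

Lemma bump_le1 J t : 0 <= t <= 1 -> bump J t <= 1.
Proof.
move=> /andP[t0 t1]; rewrite mulr_ile1// ?exprn_ge0 ?exprn_ile1 ?subr_ge0//.
by rewrite gerBl.
Qed.

(** Because the weight vanishes to order [J] at both ends, the boundary terms of
  [J]-fold summation by parts are no larger than the final sum. *)
Lemma bump_phase_boundary J k : exists2 K, 0 <= K & forall M gamma j,
  (0 < M)%N -> (j <= J)%N ->
  cabs (iter j (@fdiff R[i]) (bump_phase J k M gamma) 0%N) <=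
    K * M%:R^-1 ^+ J /\
  cabs (iter j (@fdiff R[i]) (bump_phase J k M gamma) M) <=
    K * M%:R^-1 ^+ J.
Proof.
pose E : R := (J%:R * (1 + J%:R)) ^+ J.
have E0 : 0 <= E by rewrite exprn_ge0// mulr_ge0// addr_ge0.
exists (2 ^+ J * E); first by rewrite mulr_ge0// exprn_ge0.
move=> M gamma j M0 jJ.
have M0' : 0 < M%:R :> R by rewrite ltr0n.
have M1 : 1 <= M%:R :> R by rewrite ler1n.
have Mi0 : 0 <= M%:R^-1 :> R by rewrite invr_ge0 ltW.
have bumpE t (z : R) : cabs ((bump J t)%:C * expe z) = `|t * (1 - t)| ^+ J.
  by rewrite cabsM cabs_expe mulr1 cabs_real /bump -exprMn normrX.
have small (t u : R) : `|t| <= J%:R / M%:R -> `|u| <= 1 + J%:R ->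
    `|t * u| ^+ J <= E * M%:R^-1 ^+ J.
  move=> Ht Hu; rewrite /E -exprMn lerXn2r ?nnegrE ?normr_ge0//.
  by rewrite normrM mulrAC ler_pM.
have Jle (i : nat) : (i <= J)%N -> i%:R / M%:R <= J%:R :> R.
  move=> iJ; rewrite ler_pdivrMr// (@le_trans _ _ J%:R)// ?ler_nat//.
  by rewrite ler_peMr.
have sup (l : nat) : (forall i, (l <= i <= j + l)%N ->
      cabs (bump_phase J k M gamma i) <= E * M%:R^-1 ^+ J) ->
    cabs (iter j (@fdiff R[i]) (bump_phase J k M gamma) l) <=
      2 ^+ J * E * M%:R^-1 ^+ J.
  move=> H; apply: le_trans (iter_fdiff_le_sup (@cabsD R) (@cabsN R) H) _.
  by rewrite -mulrA ler_wpM2r ?mulr_ge0 ?exprn_ge0// ler_weXn2l// ler1n.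
split; apply: sup => i ij; rewrite bumpE.
  apply: small.
    rewrite ger0_norm ?divr_ge0// ler_wpM2r// ler_nat; lia.
  apply: le_trans (ler_normB _ _) _; rewrite normr1 lerD2l ger0_norm ?divr_ge0//.
  apply: Jle; lia.
have -> : i = (M + (i - M))%N by lia.
have iM : (i - M <= J)%N by lia.
rewrite natrD mulrDl divff ?gt_eqF// mulrC; apply: small.
  rewrite opprD addrA subrr add0r normrN ger0_norm ?divr_ge0//.
  by rewrite ler_wpM2r// ler_nat.
rewrite ger0_norm ?addr_ge0 ?divr_ge0// lerD2l; exact: Jle.
Qed.

End SmoothWeight.

Section PeriodicAveraging.
Variable R : realType.
Implicit Types (c g : nat -> R[i]) (p l J M : nat).

Lemma sum_periodic_shift (V : zmodType) (f : nat -> V) p :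
  (forall l, f (l + p)%N = f l) ->
  \sum_(0 <= l < p) f l.+1 = \sum_(0 <= l < p) f l.
Proof.
move=> fp; apply: (@addrI _ (f 0%N)).
rewrite -(big_nat_recl p 0 f)// big_nat_recr//= addrC.
by rewrite -(fp 0%N) add0n.
Qed.

Lemma periodic_mod (T : Type) (f : nat -> T) p :
  (forall l, f (l + p)%N = f l) -> forall l, f l = f (l %% p)%N.
Proof.
move=> fp l; rewrite {1}(divn_eq l p).
by elim: (l %/ p)%N => [|i IH] //; rewrite mulSn -addnA addnC fp.
Qed.

(** The discrete antiderivative of [c], normalised to have mean zero over a
  period, so that it can be summed again. *)
Definition antidiff p c : nat -> R[i] := fun l =>
  \sum_(0 <= i < l) c i -
  (p%:R^-1)%:C * \sum_(0 <= l' < p) \sum_(0 <= i < l') c i.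

Lemma fdiff_antidiff p c l : antidiff p c l.+1 - antidiff p c l = c l.
Proof. by rewrite /antidiff big_nat_recr//=; ring. Qed.

Lemma antidiff_periodic p c : (forall l, c (l + p)%N = c l) ->
  \sum_(0 <= l < p) c l = 0 ->
  forall l, antidiff p c (l + p)%N = antidiff p c l.
Proof.
move=> cp c0 l; rewrite /antidiff; congr (_ - _).
elim: l => [|l IH]; first by rewrite c0 big_geq.
by rewrite addSn !big_nat_recr//= IH cp.
Qed.

Lemma antidiff_sum p c : (0 < p)%N -> \sum_(0 <= l < p) antidiff p c l = 0.
Proof.
move=> p0; rewrite sumrB sumr_const_nat subn0.
rewrite -[_ *+ p]mulr_natl mulrA.
have -> : p%:R = (p%:R)%:C :> R[i] by rewrite rmorph_nat.
by rewrite -rmorphM/= divff ?pnatr_eq0 -?lt0n// mul1r subrr.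
Qed.

Lemma cabs_antidiff_le p c Lam : (0 < p)%N -> (forall l, c (l + p)%N = c l) ->
  \sum_(0 <= l < p) c l = 0 -> \sum_(0 <= l < p) cabs (c l) <= Lam ->
  forall l, cabs (antidiff p c l) <= 2 * Lam.
Proof.
move=> p0 cp c0 cL l; rewrite (periodic_mod (antidiff_periodic cp c0)).
have part l' : (l' <= p)%N -> cabs (\sum_(0 <= i < l') c i) <= Lam.
  move=> lp; apply: le_trans (cabs_sum _ _ _) (le_trans _ cL).
  rewrite [leRHS](big_cat_nat (leq0n l') lp)/= lerDl.
  by apply: sumr_ge0 => i _; exact: cabs_ge0.
apply: le_trans (cabsB _ _) _; rewrite mulr_natl mulr2n; apply: lerD.
  by apply: part; rewrite ltnW// ltn_mod.
rewrite cabsM cabs_real ger0_norm ?invr_ge0// mulrC ler_pdivrMr ?ltr0n//.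
apply: le_trans (cabs_sum _ _ _) _.
apply: (@le_trans _ _ (\sum_(0 <= l' < p) Lam)).
  by apply: ler_sum_nat => l' /andP[_ lp]; apply: part; exact: ltnW.
by rewrite sumr_const_nat subn0 mulr_natr.
Qed.

Lemma sum_by_parts M (g C : nat -> R[i]) :
  \sum_(0 <= l < M) g l * (C l.+1 - C l) =
  g M * C M - g 0%N * C 0%N - \sum_(0 <= l < M) fdiff g l * C l.+1.
Proof.
elim: M => [|M IH]; first by rewrite !big_geq// subrr subr0.
by rewrite !big_nat_recr//= IH /fdiff; ring.
Qed.

(** Summation by parts, [J] times: every step trades one difference of [g] for
  one antiderivative of [c], and the latter costs only a factor [2 p].  Only the
  sum of [|c|] over a period enters, because [c] will be a large multiple of the
  indicator of a sparse set. *)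
Lemma periodic_sum_by_parts J M p c g Lam b B : (0 < p)%N ->
  0 <= b -> 0 <= B -> 0 <= Lam ->
  (forall l, c (l + p)%N = c l) ->
  \sum_(0 <= l < p) c l = 0 -> \sum_(0 <= l < p) cabs (c l) <= Lam ->
  (forall j, (j <= J)%N -> cabs (iter j (@fdiff R[i]) g 0%N) <= b) ->
  (forall j, (j <= J)%N -> cabs (iter j (@fdiff R[i]) g M) <= b) ->
  (forall l, (l < M)%N -> cabs (iter J.+1 (@fdiff R[i]) g l) <= B) ->
  cabs (\sum_(0 <= l < M) g l * c l) <=
    2 * Lam * (2 * p%:R) ^+ J * (2 * J.+1%:R * b + M%:R * B).
Proof.
move=> p0; have p1 : 1 <= p%:R :> R by rewrite ler1n.
elim: J c g Lam => [|J IH] c g Lam b0 B0 L0 cp c0 cL g0 gM gB.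
all: have anti_le := cabs_antidiff_le p0 cp c0 cL.
all: have -> : \sum_(0 <= l < M) g l * c l =
  g M * antidiff p c M - g 0%N * antidiff p c 0%N -
  \sum_(0 <= l < M) fdiff g l * antidiff p c l.+1
  by rewrite -sum_by_parts; apply: eq_bigr => l _; rewrite fdiff_antidiff.
all: apply: le_trans (cabsB _ _) _.
all: have bdry : cabs (g M * antidiff p c M - g 0%N * antidiff p c 0%N) <=
    2 * Lam * (2 * b)
  by [apply: le_trans (cabsB _ _) _; rewrite !cabsM;
  have := ler_pM (cabs_ge0 _) (cabs_ge0 _) (gM 0%N isT) (anti_le M);
  have := ler_pM (cabs_ge0 _) (cabs_ge0 _) (g0 0%N isT) (anti_le 0%N);
  rewrite /=; lra].
  have -> : 2 * Lam * (2 * p%:R) ^+ 0 * (2 * 1 * b + M%:R * B) =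
    2 * Lam * (2 * b) + 2 * Lam * (M%:R * B) by rewrite expr0; ring.
  apply: lerD => //.
  apply: le_trans (cabs_sum _ _ _) _.
  apply: (@le_trans _ _ (\sum_(0 <= l < M) B * (2 * Lam))).
    apply: ler_sum_nat => l /andP[_ lM]; rewrite cabsM ler_pM ?cabs_ge0//.
    exact: gB.
  by rewrite sumr_const_nat subn0 -[leLHS]mulr_natr; lra.
pose c' l := antidiff p c l.+1.
have H1 : cabs (\sum_(0 <= l < M) fdiff g l * c' l) <=
    2 * (2 * p%:R * Lam) * (2 * p%:R) ^+ J * (2 * J.+1%:R * b + M%:R * B).
  apply: IH => //.
  - by rewrite !mulr_ge0.
  - by move=> l; rewrite /c' -addSn antidiff_periodic.
  - rewrite /c' sum_periodic_shift ?antidiff_sum//; exact: antidiff_periodic.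
  - apply: (@le_trans _ _ (\sum_(0 <= l < p) 2 * Lam)).
      by apply: ler_sum => l _; exact: anti_le.
    by rewrite sumr_const_nat subn0 -[leLHS]mulr_natr; lra.
  - by move=> j jJ; rewrite -iterSr; exact: g0.
  - by move=> j jJ; rewrite -iterSr; exact: gM.
  - by move=> l lM; rewrite -iterSr; exact: gB.
apply: le_trans (lerD bdry H1) _.
set P := (2 * p%:R) ^+ J; set S := _ + _ * B.
have -> : 2 * (2 * p%:R * Lam) * P * S = 2 * Lam * (2 * p%:R) ^+ J.+1 * S.
  by rewrite exprS /P; ring.
have -> : 2 * J.+2%:R * b + M%:R * B = 2 * b + S.
  by rewrite /S -(natr1 J.+1); ring.
rewrite [leRHS]mulrDr lerD2r ler_wpM2r ?mulr_ge0// ler_peMr ?mulr_ge0//.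
by rewrite exprn_ege1//; lra.
Qed.

End PeriodicAveraging.

Section MajorArcs.
Variable R : realType.
Implicit Types (J k M D q : nat) (a : int) (Y alpha beta x : R).

Definition smooth_sum J k Y alpha : R[i] :=
  (Y^-1)%:C * \sum_(1 <= m < (Num.truncn Y).+1)
    (bump J (m%:R / Y))%:C * expe (alpha * m%:R ^+ k).

(** A Riemann sum for the integral of [bump J t * e(x t ^ k)] over the unit
  interval. *)
Definition grid_integral J k M x : R[i] :=
  (M%:R^-1)%:C * \sum_(0 <= l < M) bump_phase J k M x l.

(** The normalised complete exponential sum modulo [q]. *)
Definition gauss_mean k a q : R[i] :=
  (q%:R^-1)%:C * \sum_(0 <= m < q) expe (a%:~R / q%:R * m%:R ^+ k).

Lemma cabs_mean_le1 (n : nat) (Y : R) (F : nat -> R[i]) (m : nat) :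
  0 < Y -> (n - m)%:R <= Y -> (forall i, (m <= i < n)%N -> cabs (F i) <= 1) ->
  cabs ((Y^-1)%:C * \sum_(m <= i < n) F i) <= 1.
Proof.
move=> Y0 nY F1; rewrite cabsM cabs_real ger0_norm ?invr_ge0 ?(ltW Y0)// mulrC.
rewrite ler_pdivrMr// mul1r; apply: le_trans (cabs_sum _ _ _) (le_trans _ nY).
apply: (@le_trans _ _ (\sum_(m <= i < n) 1)); first exact: ler_sum_nat.
by rewrite sumr_const_nat.
Qed.

Lemma cabs_bump_expe J t x : 0 <= t <= 1 -> cabs ((bump J t)%:C * expe x) <= 1.
Proof.
move=> t01; rewrite cabsM cabs_expe mulr1 cabs_real ger0_norm ?bump_ge0//.
exact: bump_le1.
Qed.

Lemma smooth_sum_le1 J k Y alpha : 0 < Y -> cabs (smooth_sum J k Y alpha) <= 1.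
Proof.
move=> Y0; have tY : (Num.truncn Y)%:R <= Y by rewrite truncn_le ltW.
apply: cabs_mean_le1 => //; first by rewrite subSS subn0.
move=> i /andP[_ iY]; apply: cabs_bump_expe; rewrite divr_ge0 ?(ltW Y0)//=.
by rewrite ler_pdivrMr// mul1r (le_trans _ tY)// ler_nat -ltnS.
Qed.

Lemma grid_integral_le1 J k M x : (0 < M)%N -> cabs (grid_integral J k M x) <= 1.
Proof.
move=> M0; apply: cabs_mean_le1; rewrite ?ltr0n ?subn0// => i /andP[_ iM].
apply: cabs_bump_expe; rewrite divr_ge0//= ler_pdivrMr ?ltr0n// mul1r.
by rewrite ler_nat ltnW.
Qed.

Lemma gauss_mean_le1 k a q : (0 < q)%N -> cabs (gauss_mean k a q) <= 1.
Proof.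
move=> q0; apply: cabs_mean_le1; rewrite ?ltr0n ?subn0// => i _.
by rewrite cabs_expe.
Qed.

Lemma sum_multiples (V : nmodType) D M (F : nat -> V) : (0 < D)%N ->
  \sum_(0 <= l < M.+1 | (D %| l)%N) F l =
  \sum_(0 <= m < (M %/ D).+1) F (D * m)%N.
Proof.
move=> D0; elim: M => [|M IH].
  by rewrite div0n big_mkcond !big_nat1 dvdn0 muln0.
rewrite big_mkcond big_nat_recr//= -big_mkcond IH divnS//.
case: ifP => DM /=; last by rewrite addr0.
rewrite add1n [RHS]big_nat_recr//=; congr (_ + F _).
have -> : (M %/ D).+1 = (M.+1 %/ D)%N by rewrite divnS// DM.
by rewrite mulnC divnK.
Qed.

Lemma expe_modulus a q (x y : int) : (0 < q)%N -> (q%:Z %| x - y)%Z ->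
  expe (a%:~R / q%:R * x%:~R : R) = expe (a%:~R / q%:R * y%:~R).
Proof.
move=> q0 /dvdzP[h hE].
have q0' : q%:R != 0 :> R by rewrite pnatr_eq0 -lt0n.
have -> : x = y + h * q%:Z by rewrite -hE addrC subrK.
rewrite rmorphD mulrDr expeD -[RHS]mulr1; congr (_ * _).
have -> : a%:~R / q%:R * (h * q%:Z)%:~R = (a * h)%:~R :> R.
  by rewrite !rmorphM /= -[(Posz q)%:~R]/(q%:R); field.
exact: expe_int.
Qed.

Lemma expe_periodic k a q (m : nat) : (0 < q)%N ->
  expe (a%:~R / q%:R * (m + q)%N%:R ^+ k : R) =
  expe (a%:~R / q%:R * m%:R ^+ k).
Proof.
move=> q0; have := @expe_modulus a q ((m + q)%N%:Z ^+ k) (m%:Z ^+ k) q0.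
rewrite !rmorphXn /=; apply.
have -> : (m + q)%N%:Z ^+ k - m%:Z ^+ k =
  ((m + q)%N%:Z - m%:Z) * (\sum_(i < k) (m + q)%N%:Z ^+ (k.-1 - i) * m%:Z ^+ i).
  by rewrite subrXX.
by rewrite PoszD addrAC subrr add0r dvdz_mulr.
Qed.

(** On the grid of step [1 / D] the smooth sum is the correlation of a slowly
  varying function with a [D * q]-periodic one, hence nearly the product of
  their means. *)
Lemma smooth_sum_major J k : (0 < J)%N -> exists2 K, 0 <= K &
  forall M D a q beta Y, (0 < M)%N -> (0 < D)%N -> (0 < q)%N ->
  Y = M%:R / D%:R ->
  cabs (smooth_sum J k Y (a%:~R / q%:R + beta) -
        gauss_mean k a q * grid_integral J k M (beta * Y ^+ k)) <=
  K * ((1 + `|beta * Y ^+ k|) * q%:R / Y) ^+ J.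
Proof.
move=> J0; have [K1 K10 HK1] := @slow_bump_phase R J k.
have [K2 K20 HK2] := @bump_phase_boundary R J k.
pose K3 := 2 * 2 ^+ J * (2 * J%:R * K2 + K1).
have K30 : 0 <= K3.
  by rewrite mulr_ge0 ?addr_ge0 ?mulr_ge0 ?exprn_ge0.
exists (2 + K3); first by rewrite addr_ge0.
move=> M D a q beta Y M0 D0 q0 YE.
have [M0' D0' q0'] : [/\ 0 < M%:R :> R, 0 < D%:R :> R & 0 < q%:R :> R].
  by rewrite !ltr0n.
have Y0 : 0 < Y by rewrite YE divr_gt0.
set gam := beta * Y ^+ k; set z := _ / Y.
have z0 : 0 <= z by rewrite divr_ge0 ?(ltW Y0)// mulr_ge0// addr_ge0.
have [z1|z1] := ltP 1 z.
  (* The bound exceeds the trivial one. *)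
  apply: (@le_trans _ _ 2).
    apply: le_trans (cabsB _ _) _; rewrite (_ : 2 = 1 + 1)//.
    rewrite lerD ?smooth_sum_le1// cabsM mulr_ile1 ?cabs_ge0 ?gauss_mean_le1//.
    exact: grid_integral_le1.
  rewrite -[leLHS]mulr1 ler_pM//; first by rewrite lerDl.
  by rewrite exprn_ege1// ltW.
pose p := (D * q)%N; have p0 : (0 < p)%N by rewrite muln_gt0 D0.
have p0' : 0 < p%:R :> R by rewrite ltr0n.
pose rho := (1 + `|gam|) / M%:R.
have zE : rho * p%:R = z.
  by rewrite /rho /z YE /p natrM; field; rewrite !gt_eqF.
have r0 : 0 <= rho by rewrite divr_ge0// addr_ge0.
have r1 : rho <= 1.
  by apply: le_trans z1; rewrite -zE ler_peMr// ler1n.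
have Mr : M%:R^-1 <= rho.
  by rewrite /rho ler_peMl ?invr_ge0// lerDl.
pose f (m : nat) := expe (a%:~R / q%:R * m%:R ^+ k : R).
pose V := gauss_mean k a q.
(* The factor [D] restores the mean over the sparse set of multiples of [D]. *)
pose c (l : nat) : R[i] := if (D %| l)%N then (D%:R)%:C * f (l %/ D)%N else 0.
have cp l : c (l + p)%N = c l.
  rewrite /c /p dvdn_addl ?dvdn_mulr//; case: ifP => // Dl.
  by rewrite divnDr ?dvdn_mulr// mulKn// /f expe_periodic.
have pE : p = p.-1.+1 by rewrite prednK.
have divp : (p.-1 %/ D).+1 = q.
  have := divnS p.-1 D0; rewrite -pE dvdn_mulr// /p mulKn// => ->.
have sum_c (W : zmodType) (F : R[i] -> W) : F 0 = 0 ->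
    \sum_(0 <= l < p) F (c l) = \sum_(0 <= m < q) F ((D%:R)%:C * f m).
  move=> F0; rewrite -divp {1}pE.
  transitivity (\sum_(0 <= l < p.-1.+1 | (D %| l)%N)
      F ((D%:R)%:C * f (l %/ D)%N)).
    rewrite [RHS]big_mkcond; apply: eq_bigr => l _; rewrite /c.
    by case: ifP.
  by rewrite sum_multiples//; apply: eq_bigr => m _; rewrite mulKn.
have sumc : \sum_(0 <= l < p) c l = (p%:R)%:C * V.
  rewrite (sum_c _ id)// -mulr_sumr /V /gauss_mean mulrA -rmorphM/=.
  by rewrite /p natrM mulfK ?gt_eqF.
have normc_ : \sum_(0 <= l < p) cabs (c l) = p%:R.
  rewrite (sum_c _ (@ComplexField.Normc.normc R)) ?cabs0//.
  under eq_bigr => m _ do rewrite cabsM cabs_expe mulr1 cabs_real normr_nat.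
  by rewrite sumr_const_nat subn0 /p natrM mulr_natr.
pose c0 l := c l - V.
pose g := bump_phase J k M gam.
have V1 : cabs V <= 1 by exact: gauss_mean_le1.
have bound : cabs (\sum_(0 <= l < M) g l * c0 l) <=
    2 * (2 * p%:R) * (2 * p%:R) ^+ J.-1 *
      (2 * J.-1.+1%:R * (K2 * M%:R^-1 ^+ J) + M%:R * (K1 * rho ^+ J)).
  have K2M : 0 <= K2 * M%:R^-1 ^+ J by rewrite mulr_ge0// exprn_ge0 ?invr_ge0.
  apply: periodic_sum_by_parts => //.
  - by rewrite mulr_ge0// exprn_ge0.
  - by move=> l; rewrite /c0 cp.
  - rewrite /c0 sumrB sumc sumr_const_nat subn0 -(mulr_natl V p).
    by rewrite -(rmorph_nat (real_complex R)) subrr.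
  - apply: (@le_trans _ _ (\sum_(0 <= l < p) (cabs (c l) + 1))).
      by apply: ler_sum => l _; apply: le_trans (cabsB _ _) _; rewrite lerD2l.
    by rewrite big_split/= normc_ sumr_const_nat subn0 mulr_natl mulr2n.
  - by move=> j jJ; exact: (HK2 M gam j M0 (leq_trans jJ (leq_pred _))).1.
  - by move=> j jJ; exact: (HK2 M gam j M0 (leq_trans jJ (leq_pred _))).2.
  - move=> l lM; rewrite prednK//; apply: HK1 => //.
    by rewrite addnC leq_add2r ltnW.
have truncY : Num.truncn Y = (M %/ D)%N.
  apply/eqP; rewrite truncn_eq ?(ltW Y0)//; apply/andP; split.
    by rewrite YE ler_pdivlMr// -natrM ler_nat leq_divM.
  by rewrite YE ltr_pdivrMr// -natrM ltr_nat ltn_ceil.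
have sumE : smooth_sum J k Y (a%:~R / q%:R + beta) =
    (M%:R^-1)%:C * \sum_(0 <= l < M) g l * c l.
  have gM : g M = 0.
    rewrite /g /bump_phase divff ?gt_eqF// /bump subrr expr0n.
    by rewrite gtn_eqF// mulr0 mul0r.
  transitivity ((M%:R^-1)%:C * \sum_(0 <= l < M.+1 | (D %| l)%N)
      g l * ((D%:R)%:C * f (l %/ D)%N)); last first.
    congr (_ * _); rewrite big_mkcond big_nat_recr//= gM !mul0r if_same addr0.
    by apply: eq_bigr => l _; rewrite /c; case: ifP => // _; rewrite mulr0.
  rewrite sum_multiples// big_ltn// muln0.
  have -> : g 0%N = 0.
    by rewrite /g /bump_phase mul0r /bump expr0n gtn_eqF// !mul0r.
  rewrite mul0r add0r /smooth_sum truncY.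
  rewrite !big_distrr/=; apply: eq_bigr => m _.
  rewrite mulKn// /g /bump_phase /f.
  have -> : (D * m)%N%:R / M%:R = m%:R / Y :> R.
    by rewrite natrM YE; field; rewrite !gt_eqF.
  have -> : (a%:~R / q%:R + beta) * m%:R ^+ k =
      gam * (m%:R / Y) ^+ k + a%:~R / q%:R * m%:R ^+ k.
    rewrite mulrDl addrC; congr (_ + _).
    by rewrite /gam expr_div_n -mulrA (mulrCA (Y ^+ k)) divff ?mulr1//
       expf_neq0// gt_eqF.
  rewrite expeD.
  have -> : (Y^-1)%:C = (M%:R^-1)%:C * (D%:R)%:C :> R[i].
    by rewrite -rmorphM/= YE invf_div mulrC.
  ring.
have -> : smooth_sum J k Y (a%:~R / q%:R + beta) - V * grid_integral J k M gam =
    (M%:R^-1)%:C * \sum_(0 <= l < M) g l * c0 l.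
  rewrite sumE /grid_integral mulrCA -mulrBr; congr (_ * _).
  rewrite big_distrr/= -sumrB; apply: eq_bigr => l _.
  by rewrite /c0 /g; ring.
rewrite cabsM cabs_real ger0_norm ?invr_ge0//.
have Mi1 : M%:R^-1 <= 1 :> R by rewrite invf_le1// ler1n.
apply: le_trans (ler_wpM2l _ bound) _; first by rewrite invr_ge0.
have -> : 2 * (2 * p%:R) * (2 * p%:R) ^+ J.-1 = 2 * 2 ^+ J * p%:R ^+ J :> R.
  by rewrite -mulrA -exprS prednK// exprMn mulrA.
rewrite prednK//.
have -> : M%:R^-1 * (2 * 2 ^+ J * p%:R ^+ J *
    (2 * J%:R * (K2 * M%:R^-1 ^+ J) + M%:R * (K1 * rho ^+ J))) =
  2 * 2 ^+ J * (2 * J%:R * K2 * (M%:R^-1 * (M%:R^-1 * p%:R) ^+ J) +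
     K1 * (rho * p%:R) ^+ J).
  rewrite !exprMn; field; by rewrite gt_eqF.
apply: (@le_trans _ _ (K3 * z ^+ J)); last first.
  by rewrite ler_wpM2r ?exprn_ge0// lerDr.
rewrite /K3 zE -[leRHS]mulrA ler_wpM2l ?mulr_ge0 ?exprn_ge0//.
rewrite [leRHS]mulrDl lerD2r.
rewrite ler_wpM2l ?mulr_ge0//; apply: (@le_trans _ _ ((M%:R^-1 * p%:R) ^+ J)).
  by rewrite ler_piMl// exprn_ge0// mulr_ge0// invr_ge0.
have Mp0 : 0 <= M%:R^-1 * p%:R :> R by rewrite mulr_ge0 ?invr_ge0.
by apply: lerXn2r => //; rewrite -zE ler_wpM2r.
Qed.

End MajorArcs.

(** * Consequences of Weyl-admissibility *)

Section WeylConsequences.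
Variable R : realType.
Implicit Types (J k q n m : nat) (a : int) (X Y alpha sigma delta t : R).

Lemma powR_mono (x y r : R) : 0 <= r -> 0 <= x -> x <= y -> x `^ r <= y `^ r.
Proof.
by move=> r0 x0 xy; apply: ge0_ler_powR => //; rewrite nnegrE// (le_trans x0).
Qed.

Lemma powRD_gt0 (x r s : R) : 0 < x -> x `^ (r + s) = x `^ r * x `^ s.
Proof. by move=> x0; rewrite powRD// (gt_eqF x0) implybT. Qed.

Definition weyl_factor k q Y : R := q%:R^-1 + Y^-1 + q%:R / Y ^+ k.

Lemma weyl_factor_ge0 k q Y : 0 < Y -> 0 <= weyl_factor k q Y.
Proof.
by move=> Y0; rewrite !addr_ge0 ?invr_ge0 ?divr_ge0 ?exprn_ge0// ltW.
Qed.

Lemma weyl_admissible_nonneg k sigma delta : weyl_admissible k sigma ->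
  0 < delta -> exists2 C, 0 <= C & forall X alpha a q,
    0 < X -> (0 < q)%N -> coprimez a q%:Z ->
    `|alpha - a%:~R / q%:R| <= q%:R ^- 2 ->
    cabs (weyl_sum k alpha X) <=
      C * (X * X `^ delta * weyl_factor k q X `^ sigma).
Proof.
move=> [_ H] /H [C HC]; exists `|C| => // X alpha a q X0 q0 aq aaq.
apply: le_trans (HC X alpha a q X0 q0 aq aaq) _.
rewrite powRD_gt0// powRr1 ?(ltW X0)// -!mulrA.
rewrite ler_wpM2r ?ler_norm//.
by rewrite mulr_ge0 ?(ltW X0)// mulr_ge0 ?powR_ge0.
Qed.

Lemma weyl_sum_nat k alpha n :
  weyl_sum k alpha (n%:R) = \sum_(1 <= m < n.+1) expe (alpha * m%:R ^+ k).
Proof. by rewrite /weyl_sum natrK. Qed.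

(** An exponent above one would make the sums at [alpha = 1 / q] of the lengths
  [q - 1] and [q] tend to zero, although they differ by a number of modulus
  one. *)
Lemma weyl_admissible_le1 k sigma : (1 < k)%N ->
  weyl_admissible k sigma -> sigma <= 1.
Proof.
move=> k1 adm; rewrite leNgt; apply/negP => s1.
pose d := (sigma - 1) / 2; have d0 : 0 < d by rewrite divr_gt0// subr_gt0.
have [C C0 HC] := weyl_admissible_nonneg adm d0.
have s0 : 0 <= sigma by rewrite ltW// (lt_trans _ s1).
pose C' := C * 4 `^ sigma.
have C'0 : 0 <= C' by rewrite mulr_ge0// powR_ge0.
have part m n q : (0 < m)%N -> (n <= q)%N -> (m <= n)%N -> (q <= 2 * m)%N ->
    (0 < n)%N -> q = m.+1 ->
    cabs (weyl_sum k (q%:R^-1) (n%:R)) <= C' * m%:R `^ (- d).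
  move=> m0 nq mn qm n0 qE.
  have q0 : (0 < q)%N by rewrite qE.
  have n0' : 0 < n%:R :> R by rewrite ltr0n.
  have m0' : 0 < m%:R :> R by rewrite ltr0n.
  have q0' : 0 < q%:R :> R by rewrite ltr0n.
  have cop : coprimez 1 q%:Z by rewrite coprimezE coprime1n.
  have := HC n%:R (q%:R^-1) 1 q n0' q0 cop; rewrite div1r subrr normr0.
  rewrite invr_ge0 exprn_ge0// => /(_ isT) H; apply: le_trans H _.
  have mle : m%:R <= n%:R :> R by rewrite ler_nat.
  have W4 : weyl_factor k q n%:R <= 4 / n%:R.
    have i1 : q%:R^-1 <= n%:R^-1 :> R by rewrite lef_pV2 ?posrE// ler_nat.
    have i3 : q%:R / n%:R ^+ k <= 2 / n%:R :> R.
      rewrite ler_pdivrMr ?exprn_gt0// mulrAC ler_pdivlMr//.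
      apply: (@le_trans _ _ (2 * n%:R * n%:R)).
        rewrite ler_wpM2r ?(ltW n0')// -natrM ler_nat (leq_trans qm)//.
        by rewrite leq_mul2l mn orbT.
      rewrite -mulrA ler_wpM2l// -expr2 ler_weXn2l// ler1n//.
    rewrite /weyl_factor; lra.
  have -> : C' * m%:R `^ (- d) = C * (4 `^ sigma * m%:R `^ (- d)).
    by rewrite mulrA.
  rewrite ler_wpM2l//.
  apply: (@le_trans _ _ (n%:R * n%:R `^ d * (4 / n%:R) `^ sigma)).
    rewrite ler_wpM2l ?mulr_ge0 ?powR_ge0//.
    by apply: ge0_ler_powR; rewrite ?nnegrE ?weyl_factor_ge0 ?divr_ge0.
  rewrite powRM ?invr_ge0// mulrCA ler_wpM2l ?powR_ge0//.
  rewrite -powR_inv1 -?powRrM// -{1}[n%:R]powRr1//.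
  rewrite -!powRD_gt0//.
  have -> : 1 + d + -1 * sigma = - d by rewrite /d; field.
  by rewrite !powRN lef_pV2 ?posrE ?powR_gt0// ge0_ler_powR ?nnegrE// ltW.
have all_m m : (0 < m)%N -> m%:R `^ d <= 2 * C'.
  move=> m0.
  have e : weyl_sum k (m.+1%:R^-1) (m.+1%:R) - weyl_sum k (m.+1%:R^-1) (m%:R)
      = expe (m.+1%:R^-1 * m.+1%:R ^+ k : R).
    by rewrite !weyl_sum_nat big_nat_recr//= addrAC subrr add0r.
  have : 1 <= C' * m%:R `^ (- d) + C' * m%:R `^ (- d).
    rewrite -[leLHS](cabs_expe (m.+1%:R^-1 * m.+1%:R ^+ k : R)) -e.
    apply: le_trans (cabsB _ _) _; apply: lerD; apply: part => //; lia.
  have md0 : 0 < m%:R `^ d :> R by rewrite powR_gt0// ltr0n.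
  rewrite powRN [X in _ <= X](_ : _ = 2 * C' / m%:R `^ d); last by ring.
  by rewrite ler_pdivlMr// mul1r.
pose Z := (2 * C' + 1) `^ (d^-1).
have C1 : 0 < 2 * C' + 1 by rewrite ltr_wpDl// mulr_ge0.
have Z0 : 0 < Z by rewrite powR_gt0.
have [_ hm] := andP (truncn_itv (ltW Z0)).
have := all_m (Num.truncn Z).+1 isT.
apply/negP; rewrite -ltNge.
apply: (@lt_le_trans _ _ (2 * C' + 1)); first by rewrite ltrDl.
have -> : 2 * C' + 1 = Z `^ d.
  by rewrite /Z -powRrM mulVf ?gt_eqF// powRr1 ?ltW.
by rewrite ge0_ler_powR ?nnegrE ?(ltW Z0) ?(ltW hm)// ltW.
Qed.

Lemma scale_powR_le (r z sigma : R) : 0 <= sigma <= 1 -> 0 < r -> r <= 1 ->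
  0 <= z -> r * z `^ sigma <= (r * z) `^ sigma.
Proof.
move=> /andP[s0 s1] r0 r1 z0; rewrite powRM ?(ltW r0)// ler_wpM2r ?powR_ge0//.
by rewrite ger1_powR// r0.
Qed.

(** The factor [(Y / X) ^ k] compensates for the use of the length [Y] instead
  of [X] in the Weyl bound; this needs [sigma <= 1]. *)
Lemma weyl_factor_mono k q X Y sigma : (0 < k)%N -> 0 <= sigma <= 1 ->
  0 < Y -> Y <= X ->
  (Y / X) ^+ k * weyl_factor k q Y `^ sigma <= weyl_factor k q X `^ sigma.
Proof.
move=> k0 s01 Y0 YX; have X0 : 0 < X by exact: lt_le_trans YX.
have [s0 _] := andP s01.
have r0 : 0 <= Y / X by rewrite divr_ge0 ?(ltW X0) ?(ltW Y0).
have r1 : Y / X <= 1 by rewrite ler_pdivrMr// mul1r.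
apply: le_trans (scale_powR_le s01 _ _ (weyl_factor_ge0 k q Y0)) _.
- by rewrite exprn_gt0// divr_gt0.
- exact: exprn_ile1.
rewrite ge0_ler_powR ?nnegrE ?mulr_ge0 ?exprn_ge0 ?weyl_factor_ge0//.
rewrite /weyl_factor !mulrDr; apply: lerD; first apply: lerD.
- by rewrite ler_piMl ?invr_ge0// exprn_ile1.
- apply: (@le_trans _ _ (Y / X * Y^-1)).
    rewrite ler_wpM2r ?invr_ge0 ?(ltW Y0)// -[leRHS]expr1.
    by rewrite ler_wiXn2l.
  by rewrite mulrAC divff ?gt_eqF// mul1r.
- by rewrite expr_div_n mulrC mulrA divfK ?expf_neq0 ?gt_eqF.
Qed.

Lemma exprn_sub_le J (x y : R) : 0 <= y -> y <= x ->
  x ^+ J.+1 - y ^+ J.+1 <= J.+1%:R * (x - y) * x ^+ J.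
Proof.
move=> y0 yx; have x0 : 0 <= x by exact: le_trans yx.
rewrite subrXX [leRHS](_ : _ = (x - y) * (J.+1%:R * x ^+ J)); last by ring.
rewrite ler_wpM2l ?subr_ge0//.
apply: (@le_trans _ _ (\sum_(i < J.+1) x ^+ J)).
  apply: ler_sum => i _; apply: (@le_trans _ _ (x ^+ (J.+1.-1 - i) * x ^+ i)).
    by rewrite ler_wpM2l ?exprn_ge0// lerXn2r.
  by rewrite -exprD subnK// -ltnS.
by rewrite sumr_const card_ord mulr_natl.
Qed.

(** The vanishing at the origin gives the factor [t ^ (k - 1)], which will make
  the short prefixes harmless in a partial summation. *)
Lemma bump_step J k : (0 < k)%N -> (k <= J)%N -> exists2 K, 0 <= K &
  forall t h : R, 0 < h -> h <= t -> t + h <= 1 ->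
  `|bump J (t + h) - bump J t| <= K * h * t ^+ k.-1.
Proof.
case: k => // k _; case: J => // J kJ.
exists (J.+1%:R * 2 ^+ J + J.+1%:R).
  by rewrite addr_ge0// mulr_ge0// exprn_ge0.
move=> t h h0 ht th1 /=.
have t0 : 0 <= t by rewrite (le_trans (ltW h0)).
have t1 : t <= 1 by rewrite (le_trans _ th1)// lerDl ltW.
pose u := 1 - t; pose v := 1 - (t + h).
have v0 : 0 <= v by rewrite subr_ge0.
have vu : v <= u by rewrite /u /v; lra.
have u1 : u <= 1 by rewrite /u; lra.
have uv : u - v = h by rewrite /u /v; ring.
have -> : bump J.+1 (t + h) - bump J.+1 t =
   ((t + h) ^+ J.+1 - t ^+ J.+1) * v ^+ J.+1 -
   t ^+ J.+1 * (u ^+ J.+1 - v ^+ J.+1).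
  by rewrite /bump -/u -/v; ring.
have tth : t <= t + h by rewrite lerDl ltW.
have tk : t ^+ J <= t ^+ k by rewrite ler_wiXn2l.
have A1 := exprn_sub_le J t0 tth; have A2 := exprn_sub_le J v0 vu.
rewrite uv in A2; rewrite (addrC t) addrK in A1.
have B1 : 0 <= (h + t) ^+ J.+1 - t ^+ J.+1.
  by rewrite subr_ge0 lerXn2r ?nnegrE ?addr_ge0 ?(ltW h0)// lerDr ltW.
have B2 : 0 <= u ^+ J.+1 - v ^+ J.+1.
  by rewrite subr_ge0 lerXn2r ?nnegrE// (le_trans v0).
have C1 : (h + t) ^+ J.+1 - t ^+ J.+1 <= J.+1%:R * 2 ^+ J * h * t ^+ k.
  apply: le_trans A1 _.
  apply: (@le_trans _ _ (J.+1%:R * h * (2 * t) ^+ J)).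
    rewrite ler_wpM2l ?mulr_ge0 ?(ltW h0)// lerXn2r ?nnegrE ?addr_ge0 ?(ltW h0)//.
      by rewrite mulr_ge0.
    by lra.
  rewrite exprMn [leLHS](_ : _ = J.+1%:R * 2 ^+ J * h * t ^+ J); last by ring.
  by rewrite ler_wpM2l// !mulr_ge0 ?exprn_ge0// ltW.
have C2 : u ^+ J.+1 - v ^+ J.+1 <= J.+1%:R * h.
  apply: le_trans A2 _; rewrite ler_piMr ?mulr_ge0 ?(ltW h0)//.
  by rewrite exprn_ile1// (le_trans v0).
have v1 : v ^+ J.+1 <= 1 by rewrite exprn_ile1// (le_trans vu).
have tJ : t ^+ J.+1 <= t ^+ k by rewrite ler_wiXn2l// ltnW.
rewrite (addrC t); apply: le_trans (ler_normB _ _) _.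
rewrite ger0_norm ?mulr_ge0 ?exprn_ge0// ger0_norm ?mulr_ge0 ?exprn_ge0//.
rewrite [leRHS](_ : _ = J.+1%:R * 2 ^+ J * h * t ^+ k +
  t ^+ k * (J.+1%:R * h)); last by ring.
apply: lerD; first by apply: le_trans C1; rewrite ler_piMr.
by rewrite ler_pM ?exprn_ge0.
Qed.

Lemma abel_sum (w : nat -> R[i]) (T : nat -> R[i]) n : T 0%N = 0 ->
  \sum_(1 <= m < n.+1) w m * (T m - T m.-1) =
  w n.+1 * T n + \sum_(1 <= m < n.+1) (w m - w m.+1) * T m.
Proof.
move=> T0; elim: n => [|n IH].
  by rewrite !big_geq// T0 mulr0 addr0.
by rewrite big_nat_recr//= IH [in RHS]big_nat_recr//=; ring.
Qed.

(** Partial summation: each prefix is bounded at its own length, and the small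
  variation of the weight near the origin pays for the short ones. *)
Lemma smooth_sum_minor J k sigma delta : (1 < k)%N -> (k <= J)%N ->
  weyl_admissible k sigma -> 0 < delta ->
  exists2 K, 0 <= K & forall Y alpha a q, 0 < Y -> (0 < q)%N ->
    coprimez a q%:Z -> `|alpha - a%:~R / q%:R| <= q%:R ^- 2 ->
    cabs (smooth_sum J k Y alpha) <=
      K * (Y `^ delta * weyl_factor k q Y `^ sigma).
Proof.
move=> k1 kJ adm d0; have s1 := weyl_admissible_le1 k1 adm.
have s0 : 0 < sigma by case: adm.
have s01 : 0 <= sigma <= 1 by rewrite (ltW s0).
have k0 : (0 < k)%N by exact: ltnW.
have [C C0 HC] := weyl_admissible_nonneg adm d0.
have [K K0 HK] := bump_step k0 kJ.
exists ((K + 1) * C); first by rewrite mulr_ge0// addr_ge0.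
move=> Y alpha a q Y0 q0 aq aaq.
have Yn0 := ltW Y0.
set n := Num.truncn Y; have nY : n%:R <= Y by rewrite truncn_le.
have Yn : Y < n.+1%:R by have /andP[] := truncn_itv Yn0.
(* The weight is cut off after [n], which absorbs the boundary term. *)
pose w m : R := if (m <= n)%N then bump J (m%:R / Y) else 0.
pose T m : R[i] := weyl_sum k alpha m%:R.
have T0 : T 0%N = 0 by rewrite /T weyl_sum_nat big_geq.
have sumE : \sum_(1 <= m < n.+1) (bump J (m%:R / Y))%:C * expe (alpha * m%:R ^+ k)
    = \sum_(1 <= m < n.+1) ((w m)%:C - (w m.+1)%:C) * T m.
  transitivity (\sum_(1 <= m < n.+1) (w m)%:C * (T m - T m.-1)).
    apply: eq_big_nat => m /andP[m0]; rewrite ltnS => mn.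
    rewrite /w mn; congr (_ * _); case: m m0 mn => // m _ mn.
    by rewrite /T !weyl_sum_nat big_nat_recr//= addrAC subrr add0r.
  by rewrite abel_sum// /w ltnn mul0r add0r.
have step m : (0 < m)%N -> (m <= n)%N ->
    `|w m - w m.+1| <= (K + 1) * Y^-1 * (m%:R / Y) ^+ k.-1.
  move=> m0 mn.
  have m0' : 1 <= m%:R :> R by rewrite ler1n.
  have t0 : 0 <= m%:R / Y by rewrite divr_ge0.
  have t1 : m%:R / Y <= 1.
    by rewrite ler_pdivrMr// mul1r (le_trans _ nY)// ler_nat.
  have P0 : 0 <= Y^-1 * (m%:R / Y) ^+ k.-1.
    by rewrite mulr_ge0 ?exprn_ge0 ?invr_ge0.
  rewrite /w mn; case: ltnP => mn'.
    rewrite distrC -natr1 mulrDl mul1r.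
    apply: (@le_trans _ _ (K * Y^-1 * (m%:R / Y) ^+ k.-1)).
      apply: HK; first by rewrite invr_gt0.
        by rewrite ler_peMl ?invr_ge0.
      rewrite -[X in _ + X]mul1r -mulrDl natr1 ler_pdivrMr// mul1r.
      by rewrite (le_trans _ nY)// ler_nat.
    by rewrite mulrDl mul1r mulrDl lerDl.
  have mE : m = n by apply/eqP; rewrite eqn_leq mn.
  rewrite subr0 ger0_norm ?bump_ge0 ?t0//.
  apply: (@le_trans _ _ (Y^-1 * (m%:R / Y) ^+ k.-1)); last first.
    by rewrite mulrDl mul1r mulrDl lerDr -mulrA mulr_ge0.
  rewrite /bump mulrC ler_pM ?exprn_ge0 ?subr_ge0//; last first.
    by rewrite ler_wiXn2l// (leq_trans (leq_pred _)).
  apply: (@le_trans _ _ (1 - m%:R / Y)).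
    rewrite -[leRHS]expr1 ler_wiXn2l ?subr_ge0 ?gerBl// (leq_trans k0)//.
  rewrite -[X in X - _](@divff _ Y) ?gt_eqF// -mulrBl ler_piMl ?invr_ge0//.
  by rewrite mE lerBlDr addrC natr1 ltW.
have term m : (0 < m)%N -> (m <= n)%N ->
    `|w m - w m.+1| * cabs (T m) <=
    (K + 1) * C * Y `^ delta * weyl_factor k q Y `^ sigma.
  move=> m0 mn.
  have m0' : 0 < m%:R :> R by rewrite ltr0n.
  have mY : m%:R <= Y by rewrite (le_trans _ nY)// ler_nat.
  have := HC m%:R alpha a q m0' q0 aq aaq => HT.
  apply: (@le_trans _ _ (((K + 1) * Y^-1 * (m%:R / Y) ^+ k.-1) *
     (C * (m%:R * Y `^ delta * weyl_factor k q m%:R `^ sigma)))).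
    apply: ler_pM; rewrite ?cabs_ge0 ?step//; apply: le_trans HT _.
    rewrite ler_wpM2l// ler_wpM2r ?powR_ge0// ler_wpM2l// ?(ltW m0')//.
    by rewrite ge0_ler_powR ?nnegrE ?(ltW m0') ?(ltW d0).
  rewrite [leLHS](_ : _ = (K + 1) * C * Y `^ delta *
    ((m%:R / Y) ^+ k * weyl_factor k q m%:R `^ sigma)); last first.
    have -> : (m%:R / Y) ^+ k = m%:R / Y * (m%:R / Y) ^+ k.-1.
      by rewrite -exprS prednK.
    by ring.
  rewrite ler_wpM2l ?mulr_ge0 ?powR_ge0 ?addr_ge0//.
  exact: weyl_factor_mono.
rewrite /smooth_sum -/n sumE cabsM cabs_real ger0_norm ?invr_ge0//.
rewrite mulrC ler_pdivrMr//; apply: le_trans (cabs_sum _ _ _) _.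
have B0 : 0 <= (K + 1) * C * Y `^ delta * weyl_factor k q Y `^ sigma.
  by rewrite !mulr_ge0 ?powR_ge0// addr_ge0.
apply: (@le_trans _ _ (\sum_(1 <= m < n.+1)
   (K + 1) * C * Y `^ delta * weyl_factor k q Y `^ sigma)).
  apply: ler_sum_nat => m /andP[m0 mn].
  have -> : (w m)%:C - (w m.+1)%:C = (w m - w m.+1)%:C :> R[i].
    by rewrite rmorphB.
  by rewrite cabsM cabs_real term.
rewrite sumr_const_nat subSS subn0 -[leLHS]mulr_natr mulrA.
by rewrite ler_wpM2l// mulrA.
Qed.

(** A complete sum is a Weyl sum of length [q]. *)
Lemma gauss_mean_minor k sigma delta : (1 < k)%N ->
  weyl_admissible k sigma -> 0 < delta ->
  exists2 K, 0 <= K & forall a q, (0 < q)%N -> coprimez a q%:Z ->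
    cabs (gauss_mean R k a q) <= K * (q%:R `^ delta * (q%:R^-1) `^ sigma).
Proof.
move=> k1 adm d0; have s0 : 0 < sigma by case: adm.
have [C C0 HC] := weyl_admissible_nonneg adm d0.
exists (C * 3 `^ sigma); first by rewrite mulr_ge0 ?powR_ge0.
move=> a q q0 aq; have q0' : 0 < q%:R :> R by rewrite ltr0n.
have -> : gauss_mean R k a q =
    (q%:R^-1)%:C * weyl_sum k (a%:~R / q%:R) q%:R.
  rewrite weyl_sum_nat big_add1/=; congr (_ * _).
  rewrite (@sum_periodic_shift _ (fun m => expe (a%:~R / q%:R * m%:R ^+ k : R)))//.
  by move=> l; exact: (@expe_periodic R k a q l q0).
rewrite cabsM cabs_real ger0_norm ?invr_ge0// mulrC ler_pdivrMr//.
have := HC q%:R (a%:~R / q%:R) a q q0' q0 aq; rewrite subrr normr0.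
rewrite invr_ge0 exprn_ge0// => /(_ isT) H; apply: le_trans H _.
rewrite [leRHS](_ : _ = C * (q%:R * q%:R `^ delta * (3 / q%:R) `^ sigma)).
  rewrite ler_wpM2l// ler_wpM2l ?mulr_ge0 ?powR_ge0//.
  apply: ge0_ler_powR; rewrite ?nnegrE ?weyl_factor_ge0 ?divr_ge0 ?(ltW s0)//.
  have : q%:R / q%:R ^+ k <= q%:R^-1 :> R.
    rewrite ler_pdivrMr ?exprn_gt0// mulrC ler_pdivlMr// -expr2.
    by rewrite ler_weXn2l// ler1n.
  rewrite /weyl_factor; lra.
by rewrite powRM ?invr_ge0//; ring.
Qed.

(** For odd [k] the substitution [m -> - m] conjugates the complete sum. *)
Lemma gauss_mean_real k a q : odd k -> (0 < q)%N ->
  gauss_mean R k a q = (complex.Re (gauss_mean R k a q))%:C.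
Proof.
move=> k_odd q0.
suff : (gauss_mean R k a q)^*%C = gauss_mean R k a q.
  case: (gauss_mean R k a q) => x y /= [] yE; congr Complex; lra.
have conjM (z w : R[i]) : (z * w)^*%C = z^*%C * w^*%C by exact: rmorphM.
rewrite /gauss_mean conjM conjc_real; congr (_ * _).
have conj_sum (F : nat -> R[i]) :
    (\sum_(0 <= m < q) F m)^*%C = \sum_(0 <= m < q) (F m)^*%C.
  exact: rmorph_sum.
rewrite -[RHS](sum_periodic_shift (fun l => @expe_periodic R k a q l q0)).
rewrite conj_sum big_nat_rev; apply: eq_big_nat => m /andP[_ mq].
rewrite add0n -expe_conj -mulrN.
have := @expe_modulus R a q (- ((q - m.+1)%:Z ^+ k)) (m.+1%:Z ^+ k) q0.
rewrite rmorphN !rmorphXn; apply.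
have -> : - ((q - m.+1)%:Z ^+ k) = (m.+1%:Z - q%:Z) ^+ k.
  by rewrite -subzn// -[in RHS]opprB exprNn -signr_odd k_odd mulN1r.
rewrite subrXX; apply: dvdz_mulr.
by rewrite addrAC subrr add0r -mulN1r dvdz_mull.
Qed.

End WeylConsequences.

(** * Positivity of the Fejer averages *)

Section Positivity.
Variable R : realType.
Implicit Types (s n N M : nat) (x t theta : R).

Lemma expe_sum (I : Type) (r : seq I) (P : pred I) (F : I -> R) :
  expe (\sum_(i <- r | P i) F i) = \prod_(i <- r | P i) expe (F i).
Proof. exact: (big_morph _ (@expeD R) (@expe0 R)). Qed.

Lemma exp_sum_power s n (w t : 'I_n -> R) x :
  (\sum_(l < n) (w l)%:C * expe (x * t l)) ^+ s =
  \sum_(f : {ffun 'I_s -> 'I_n})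
    (\prod_i w (f i))%:C * expe (x * \sum_i t (f i)).
Proof.
rewrite -{1}(card_ord s) -prodr_const.
rewrite (bigA_distr_bigA (fun (_ : 'I_s) l => (w l)%:C * expe (x * t l))).
apply: eq_bigr => f _; rewrite big_split/= -expe_sum -mulr_sumr; congr (_ * _).
by rewrite rmorph_prod.
Qed.

Lemma sum_cos_sqr N theta :
  (\sum_(0 <= u < N) cos (u%:R * theta)) ^+ 2 +
  (\sum_(0 <= u < N) sin (u%:R * theta)) ^+ 2 =
  N%:R + 2 * \sum_(1 <= u < N) (N - u)%:R * cos (u%:R * theta).
Proof.
elim: N => [|N IH]; first by rewrite !big_geq// expr0n mulr0 addr0.
have -> : \sum_(1 <= u < N.+1) (N.+1 - u)%:R * cos (u%:R * theta) =
    \sum_(1 <= u < N) (N - u)%:R * cos (u%:R * theta) +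
    \sum_(1 <= u < N.+1) cos (u%:R * theta).
  case: N {IH} => [|N]; first by rewrite !big_geq// addr0.
  rewrite big_nat_recr//= subSn// subnn mul1r.
  rewrite [in RHS](@big_nat_recr _ _ _ N.+1)//= addrA -big_split/=; congr (_ + _).
  apply: eq_big_nat => u /andP[_ uN]; rewrite subSn; last by rewrite ltnW.
  by rewrite -natr1 mulrDl mul1r.
have -> : \sum_(1 <= u < N.+1) cos (u%:R * theta) =
    (\sum_(0 <= u < N) cos (u%:R * theta)) * cos (N%:R * theta) +
    (\sum_(0 <= u < N) sin (u%:R * theta)) * sin (N%:R * theta).
  rewrite big_add1/= big_nat_rev/= !mulr_suml -big_split/=.
  apply: eq_big_nat => u /andP[_ uN]; rewrite add0n -subSn// subSS natrB ?(ltnW uN)//.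
  rewrite mulrBl cosB; ring.
rewrite !big_nat_recr//= -natr1.
have := cos2Dsin2 (N%:R * theta); lra.
Qed.

(** Twice the sum plus [N] is Fejer's kernel, a square. *)
Lemma fejer_ge N theta : - (N%:R / 2) <=
  \sum_(1 <= u < N) (N - u)%:R * complex.Re (expe (u%:R * theta) : R[i]).
Proof.
have E : \sum_(1 <= u < N) (N - u)%:R * complex.Re (expe (u%:R * theta) : R[i])
    = \sum_(1 <= u < N) (N - u)%:R * cos (u%:R * (2 * pi * theta)).
  by apply: eq_bigr => u _ /=; rewrite mulrCA.
rewrite {}E; have := sum_cos_sqr N (2 * pi * theta).
set S := \sum_(1 <= u < N) _; set a := _ ^+ 2; set b := _ ^+ 2 => H.
have : 0 <= a + b by rewrite addr_ge0// sqr_ge0.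
lra.
Qed.

(** A power of [grid_integral] is a combination of characters with nonnegative
  coefficients of total mass at most one, so Fejer's bound applies to each of
  them. *)
Lemma grid_integral_fejer J k M s N beta : (0 < M)%N ->
  - (N%:R / 2) <= \sum_(1 <= u < N)
    (N - u)%:R * complex.Re (grid_integral J k M (beta * u%:R) ^+ s : R[i]).
Proof.
move=> M0; have M0' : 0 < M%:R :> R by rewrite ltr0n.
pose w (l : 'I_M) : R := M%:R^-1 * bump J (l%:R / M%:R).
pose t (l : 'I_M) : R := (l%:R / M%:R) ^+ k.
have w0 l : 0 <= w l.
  rewrite mulr_ge0 ?invr_ge0// bump_ge0// divr_ge0//= ler_pdivrMr// mul1r.
  by rewrite ler_nat ltnW.
have gE x : grid_integral J k M x = \sum_(l < M) (w l)%:C * expe (x * t l).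
  rewrite /grid_integral big_mkord mulr_sumr; apply: eq_bigr => l _.
  rewrite /bump_phase mulrA; congr (_ * _).
  exact/esym/(rmorphM (real_complex R)).
pose W (f : {ffun 'I_s -> 'I_M}) := \prod_i w (f i).
pose tau (f : {ffun 'I_s -> 'I_M}) := \sum_i t (f i).
have W0 f : 0 <= W f by apply: prodr_ge0.
have ReE x : complex.Re (grid_integral J k M x ^+ s) =
    \sum_(f : {ffun 'I_s -> 'I_M}) W f * complex.Re (expe (x * tau f) : R[i]).
  by rewrite gE exp_sum_power Re_sum; apply: eq_bigr => f _; rewrite Re_realM.
have W1 : \sum_(f : {ffun 'I_s -> 'I_M}) W f <= 1.
  have -> : \sum_(f : {ffun 'I_s -> 'I_M}) W f =
      complex.Re (grid_integral J k M 0 ^+ s).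
    by rewrite ReE; apply: eq_bigr => f _; rewrite mul0r expe0 /= mulr1.
  apply: le_trans (ler_norm _) _; apply: le_trans (ler_Re_cabs _) _.
  by rewrite cabsX exprn_ile1 ?cabs_ge0// grid_integral_le1.
have -> : \sum_(1 <= u < N)
    (N - u)%:R * complex.Re (grid_integral J k M (beta * u%:R) ^+ s) =
    \sum_(f : {ffun 'I_s -> 'I_M}) W f * \sum_(1 <= u < N)
      (N - u)%:R * complex.Re (expe (u%:R * (beta * tau f)) : R[i]).
  under eq_bigr => u _ do rewrite ReE mulr_sumr.
  rewrite exchange_big/=; apply: eq_bigr => f _; rewrite mulr_sumr.
  apply: eq_bigr => u _; rewrite mulrCA; congr (_ * (_ * complex.Re (expe _))).
  by rewrite mulrA (mulrC u%:R).
apply: (@le_trans _ _ (\sum_(f : {ffun 'I_s -> 'I_M}) W f * - (N%:R / 2))).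
  rewrite -mulr_suml mulrN lerN2 ler_piMl// divr_ge0//.
by apply: ler_sum => f _; rewrite ler_wpM2l// fejer_ge.
Qed.

Lemma grid_integral_lipschitz J k M x y : (0 < M)%N ->
  cabs (grid_integral J k M x - grid_integral J k M y : R[i]) <=
    2 * pi * `|x - y|.
Proof.
move=> M0; have M0' : 0 < M%:R :> R by rewrite ltr0n.
rewrite /grid_integral -mulrBr -sumrB cabsM cabs_real ger0_norm ?invr_ge0//.
rewrite mulrC ler_pdivrMr//; apply: le_trans (cabs_sum _ _ _) _.
apply: (@le_trans _ _ (\sum_(0 <= l < M) (2 * pi * `|x - y|))); last first.
  by rewrite sumr_const_nat subn0 -[leLHS]mulr_natr.
apply: ler_sum_nat => l /andP[_ lM].
have t0 : 0 <= l%:R / M%:R :> R by rewrite divr_ge0.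
have t1 : l%:R / M%:R <= 1 :> R by rewrite ler_pdivrMr// mul1r ler_nat ltnW.
rewrite /bump_phase -mulrBr cabsM cabs_real ger0_norm ?bump_ge0 ?t0//.
rewrite -[leRHS]mul1r ler_pM ?cabs_ge0 ?bump_ge0 ?bump_le1 ?t0//.
apply: le_trans (cabs_expe_sub _ _) _.
rewrite -mulrBl normrM ler_wpM2l ?mulr_ge0 ?pi_ge0//.
by rewrite ler_piMr// ger0_norm ?exprn_ge0// exprn_ile1.
Qed.

End Positivity.

(** * Scales and rational approximation *)

Section Scales.
Variable R : realType.
Implicit Types (k N u Q : nat) (alpha : R).

Lemma bernoulli_ge k (x : R) : 0 <= x -> x <= 1 -> 1 - k%:R * x <= (1 - x) ^+ k.
Proof.
move=> x0 x1; elim: k => [|k IH]; first by rewrite mul0r subr0 expr0.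
rewrite exprS; apply: (@le_trans _ _ ((1 - x) * (1 - k%:R * x))).
  rewrite -natr1; have : 0 <= k%:R * (x * x) by rewrite !mulr_ge0.
  lra.
by rewrite ler_wpM2l// subr_ge0.
Qed.

(** The number of points of the mesh shared by all scales; it is taken so large
  that rounding [u ^ (1 / k)] to a fraction with this numerator costs less than
  [1 / N]. *)
Definition fine_mesh k N : nat := (2 * k * N ^ 3)%N.

Lemma fine_mesh_gt0 k N : (0 < k)%N -> (0 < N)%N -> (0 < fine_mesh k N)%N.
Proof. by move=> k0 N0; rewrite /fine_mesh !muln_gt0 k0 N0. Qed.

Definition scale_den k N u : nat :=
  (Num.truncn ((fine_mesh k N)%:R / (u%:R `^ (k%:R^-1)) : R)).+1.

Definition scale k N u : R := (fine_mesh k N)%:R / (scale_den k N u)%:R.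

(** Rounding the denominator up makes the scale an underestimate of
  [r = u ^ (1 / k)] by at most [r ^ 2 / fine_mesh k N]; Bernoulli's inequality
  carries this over to the [k]-th powers. *)
Lemma scaleP k N u : (0 < k)%N -> (0 < u)%N -> (u <= N)%N ->
  [/\ 0 < scale k N u, scale k N u ^+ k <= u%:R,
      u%:R - scale k N u ^+ k <= (2 * N%:R)^-1,
      u%:R <= 2 * scale k N u ^+ k & scale k N u <= N%:R `^ (k%:R^-1)].
Proof.
move=> k0 u0 uN; have N0 : (0 < N)%N by exact: leq_trans uN.
have k0' : 0 < k%:R :> R by rewrite ltr0n.
have N1 : 1 <= N%:R :> R by rewrite ler1n.
have N0' : 0 < N%:R :> R by rewrite ltr0n.
have u1 : 1 <= u%:R :> R by rewrite ler1n.
have u0' : 0 < u%:R :> R by rewrite ltr0n.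
have uN' : u%:R <= N%:R :> R by rewrite ler_nat.
pose r : R := u%:R `^ (k%:R^-1).
have r0 : 0 < r by rewrite powR_gt0.
have rk : r ^+ k = u%:R.
  by rewrite -powR_mulrn ?powR_ge0// -powRrM mulVf ?gt_eqF// powRr1.
have r1 : 1 <= r.
  by rewrite -[leLHS](powRr0 u%:R) ler_powR// invr_ge0 ltW.
have ru : r <= u%:R by rewrite -rk -{1}[r]expr1 ler_weXn2l.
have rN : r <= N%:R `^ (k%:R^-1).
  by rewrite ge0_ler_powR ?nnegrE ?invr_ge0// ltW.
pose M : R := (fine_mesh k N)%:R.
have ME : M = 2 * k%:R * N%:R ^+ 3 by rewrite /M /fine_mesh natrM natrM natrX.
have M0 : 0 < M by rewrite ME !mulr_gt0// exprn_gt0.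
have Mr0 : 0 <= M / r by rewrite divr_ge0 ?ltW.
pose D : R := (scale_den k N u)%:R.
have D0 : 0 < D by rewrite ltr0n.
have Dlt : M / r < D.
  by rewrite /D /scale_den; have /andP[] := truncn_itv Mr0.
have Dle : D <= M / r + 1.
  by rewrite /D /scale_den -natr1 lerD2r truncn_le.
pose Y := scale k N u; have YE : Y = M / D by [].
have Y0 : 0 < Y by rewrite YE divr_gt0.
have Yr : Y <= r.
  by rewrite YE ler_pdivrMr// mulrC -ler_pdivrMr// ltW.
have x0 : 0 <= r / M by rewrite divr_ge0 ?ltW.
have kN : k%:R * (r / M) <= (2 * N%:R * N%:R)^-1.
  rewrite mulrA ler_pdivrMr// ME.
  have -> : (2 * N%:R * N%:R)^-1 * (2 * k%:R * N%:R ^+ 3) = k%:R * N%:R :> R.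
    by field; rewrite gt_eqF.
  by rewrite ler_pM2l// (le_trans ru).
have NN1 : (2 * N%:R * N%:R)^-1 <= 1 :> R.
  rewrite invf_le1 ?mulr_gt0//; have := ler_pM ler01 ler01 N1 N1; lra.
have x1 : r / M <= 1.
  apply: le_trans NN1; apply: le_trans kN.
  by rewrite ler_peMl// ler1n.
have rY : r * (1 - r / M) <= Y.
  rewrite YE ler_pdivlMr//.
  apply: (@le_trans _ _ (r * (1 - r / M) * (M / r + 1))).
    by rewrite ler_wpM2l// mulr_ge0 ?subr_ge0// ltW.
  have -> : r * (1 - r / M) * (M / r + 1) = M - r * (r / M).
    by field; rewrite !gt_eqF.
  by rewrite gerBl; apply: mulr_ge0 => //; exact: ltW.
have Yk : u%:R * (1 - k%:R * (r / M)) <= Y ^+ k.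
  apply: (@le_trans _ _ ((r * (1 - r / M)) ^+ k)).
    by rewrite exprMn rk ler_wpM2l// bernoulli_ge.
  by rewrite lerXn2r ?nnegrE ?mulr_ge0 ?subr_ge0// ltW.
have diff : u%:R - Y ^+ k <= (2 * N%:R)^-1.
  apply: (@le_trans _ _ (u%:R * (k%:R * (r / M)))); first by lra.
  apply: (@le_trans _ _ (N%:R * (2 * N%:R * N%:R)^-1)).
    by rewrite ler_pM// mulr_ge0// ltW.
  rewrite le_eqVlt; apply/orP; left; apply/eqP; field; by rewrite gt_eqF.
have half : (2 * N%:R)^-1 <= 2^-1 :> R by rewrite lef_pV2 ?posrE// ?mulr_gt0//; lra.
split => //.
- by rewrite -rk; apply: lerXn2r => //; rewrite nnegrE ltW.
- by rewrite -/Y; lra.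
- exact: le_trans rN.
Qed.

(** Pigeonhole: two of the [Q + 1] fractional parts of [j alpha], [j <= Q], lie
  in the same interval of length [1 / Q]. *)
Lemma dirichlet_approx alpha Q : (0 < Q)%N -> exists (a : int) (q : nat),
  [/\ (0 < q)%N, (q <= Q)%N, coprimez a q%:Z &
      `|alpha - a%:~R / q%:R| <= (q%:R * Q%:R)^-1].
Proof.
move=> Q0; have Q0' : 0 < Q%:R :> R by rewrite ltr0n.
pose fl (j : nat) := Num.floor (j%:R * alpha).
pose fr (j : nat) := j%:R * alpha - (fl j)%:~R.
have fr0 j : 0 <= fr j by rewrite subr_ge0 floor_le.
have fr1 j : fr j < 1.
  by rewrite ltrBlDl; have := floorD1_gt (j%:R * alpha); rewrite intrD.
have fQ (j : 'I_Q.+1) : (Num.truncn (Q%:R * fr j) < Q)%N.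
  by rewrite truncn_lt_nat ?mulr_ge0// -[ltRHS]mulr1 ltr_pM2l.
pose f (j : 'I_Q.+1) : 'I_Q := Ordinal (fQ j).
have /injectivePn[x [y xy fxy]] : ~~ injectiveb f.
  apply/negP => /injectiveP /leq_card; rewrite !card_ord.
  by rewrite ltnn.
wlog yx : x y xy fxy / (y < x)%N.
  move=> H; have : (x : nat) != y by [].
  rewrite neq_ltn => /orP[lt|lt]; last exact: (H x y).
  by apply: (H y x) => //; rewrite eq_sym.
pose q := (x - y)%N; pose a := fl x - fl y.
have q0 : (0 < q)%N by rewrite subn_gt0.
have qQ : (q <= Q)%N by rewrite (leq_trans (leq_subr _ _))// -ltnS.
have close : `|q%:R * alpha - a%:~R| <= Q%:R^-1.
  have -> : q%:R * alpha - a%:~R = fr x - fr y.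
    by rewrite /q natrB ?(ltnW yx)// /a rmorphB/= /fr; ring.
  have tE : Num.truncn (Q%:R * fr x) = Num.truncn (Q%:R * fr y).
    by move/(congr1 val): fxy.
  have /andP[lx ux] := truncn_itv (mulr_ge0 (ltW Q0') (fr0 x)).
  have /andP[ly uy] := truncn_itv (mulr_ge0 (ltW Q0') (fr0 y)).
  rewrite tE -natr1 in lx ux; rewrite -natr1 in uy.
  rewrite -[leRHS]mul1r ler_pdivlMr// -[X in _ * X]ger0_norm ?(ltW Q0')//.
  rewrite -normrM ler_norml; apply/andP; split; lra.
pose g := gcdn `|a|%N q.
have g0 : (0 < g)%N by rewrite gcdn_gt0 q0 orbT.
have g0' : 0 < g%:R :> R by rewrite ltr0n.
have gq : q = (q %/ g * g)%N by rewrite divnK// dvdn_gcdr.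
have ga : a = ((a %/ g%:Z)%Z * g%:Z).
  rewrite divzK// dvdzE absz_nat; exact: dvdn_gcdl.
have q'0 : (0 < q %/ g)%N by rewrite divn_gt0// dvdn_leq// dvdn_gcdr.
exists (a %/ g%:Z)%Z, (q %/ g)%N; split => //.
- exact: leq_trans (leq_div _ _) qQ.
- rewrite coprimezE /coprime -(eqn_pmul2r g0) mul1n muln_gcdl -gq.
  by have /(congr1 absz) := ga; rewrite abszM absz_nat => <-.
have q'0' : 0 < (q %/ g)%N%:R :> R by rewrite ltr0n.
set q' := (q %/ g)%N in q'0' q'0 gq *; set a' := (a %/ g%:Z)%Z in ga *.
have E : alpha - a'%:~R / q'%:R = (q%:R * alpha - a%:~R) / q%:R.
  rewrite ga gq natrM rmorphM/= -[(Posz g)%:~R]/(g%:R); field.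
  by rewrite !gt_eqF.
rewrite E normrM normfV normr_nat invfM mulrC.
apply: ler_pM; rewrite ?invr_ge0//.
by rewrite lef_pV2 ?posrE ?ltr0n// ler_nat leq_div.
Qed.

End Scales.

(** * The lower bound for the van der Corput polynomial *)

Section LowerBound.
Variable R : realType.
Implicit Types (J k s N u q : nat) (a : int) (X Y alpha beta sigma e : R).

Lemma pow_scale_le k X Y t : (0 < k)%N -> 0 < Y -> Y <= X -> 0 <= t <= 1 ->
  (Y / X) ^+ k * Y `^ (- t) <= X `^ (- t).
Proof.
move=> k0 Y0 YX /andP[t0 t1]; have X0 : 0 < X by exact: lt_le_trans YX.
have r0 : 0 < Y / X by rewrite divr_gt0.
have r1 : Y / X <= 1 by rewrite ler_pdivrMr// mul1r.
have : (Y / X) ^+ k <= (Y / X) `^ t.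
  apply: (@le_trans _ _ (Y / X)).
    by rewrite -[leRHS]expr1 ler_wiXn2l// ltW.
  by rewrite ger1_powR// r0.
move=> /(ler_wpM2r (powR_ge0 Y (- t))) H; apply: le_trans H _.
rewrite powRM ?invr_ge0 ?(ltW Y0) ?(ltW X0)// -powR_inv1 ?(ltW X0)// -powRrM.
by rewrite mulN1r mulrAC -powRD_gt0// subrr powRr0 mul1r.
Qed.

(** All three terms of the Weyl factor gain [X ^ (- (1 - e))] once the share of
  the scale [Y] is taken into account: the first because [q] is large compared
  with [Y], the second always, the third because [q] is not too large. *)
Lemma minor_factor k q X Y e : (0 < k)%N -> 0 < e < 1 -> (0 < q)%N ->
  1 <= X -> 0 < Y -> Y <= X -> Y `^ (1 - e) <= q%:R ->
  q%:R / X ^+ k <= 2 * X `^ (- (1 - e)) ->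
  (Y / X) ^+ k / q%:R <= X `^ (- (1 - e)) /\
  (Y / X) ^+ k * weyl_factor k q Y <= 4 * X `^ (- (1 - e)).
Proof.
move=> k0 /andP[e0 e1] q0 X1 Y0 YX Yq qX.
have X0 : 0 < X by exact: lt_le_trans X1.
have q0' : 0 < q%:R :> R by rewrite ltr0n.
have r0 : 0 <= (Y / X) ^+ k by rewrite exprn_ge0// divr_ge0 ?ltW.
have t01 : 0 <= 1 - e <= 1 by lra.
have T1 : (Y / X) ^+ k / q%:R <= X `^ (- (1 - e)).
  apply: le_trans (pow_scale_le k0 Y0 YX t01); rewrite ler_wpM2l//.
  by rewrite powRN lef_pV2 ?posrE ?powR_gt0.
split => //.
have T2 : (Y / X) ^+ k * Y^-1 <= X `^ (- (1 - e)).
  rewrite -[Y^-1]powR_inv1 ?(ltW Y0)//.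
  have i01 : 0 <= (1 : R) <= 1 by rewrite ler01 lexx.
  apply: le_trans (pow_scale_le k0 Y0 YX i01) _.
  by rewrite ler_powR// lerN2; lra.
have T3 : (Y / X) ^+ k * (q%:R / Y ^+ k) = q%:R / X ^+ k.
  by rewrite expr_div_n; field; rewrite !expf_neq0// gt_eqF.
rewrite /weyl_factor !mulrDr T3; lra.
Qed.

(** If [q >= Y ^ (1 - e)], both terms of the difference are small by the Weyl
  bound. If [q < Y ^ (1 - e)], then [(1 + |beta| Y ^ k) q / Y <= 2 Y ^ (- e)],
  and the condition on [J] makes the [J]-th power of this of order [1 / Y];
  replacing [Y ^ k] by [u] costs only [O(1 / N)]. *)
Lemma local_approx J k sigma e : (1 < k)%N -> (k <= J)%N ->
  weyl_admissible k sigma -> 0 < e < 1 -> 1 <= J%:R * e ->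
  exists2 K, 0 <= K & forall N u alpha a q (X := N%:R `^ (k%:R^-1))
    (B := X `^ (- sigma + k.+1%:R * e)),
    (0 < u)%N -> (u < N)%N -> (0 < q)%N -> coprimez a q%:Z ->
    q%:R <= 2 * X `^ (k%:R - 1 + e) ->
    `|alpha - a%:~R / q%:R| <= (q%:R * X `^ (k%:R - 1 + e))^-1 ->
    `|alpha - a%:~R / q%:R| <= (q%:R ^+ 2)^-1 ->
    cabs (smooth_sum J k (scale R k N u) alpha - gauss_mean R k a q *
          grid_integral J k (fine_mesh k N) ((alpha - a%:~R / q%:R) * u%:R)) <=
      K * (N%:R / u%:R * B).
Proof.
move=> k1 kJ adm e01 Je; have [e0 e1] := andP e01.
have k0 : (0 < k)%N by exact: ltnW.
have J0 : (0 < J)%N by exact: leq_trans kJ.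
have s1 := weyl_admissible_le1 k1 adm.
have s0 : 0 < sigma by case: adm.
have [K1 K10 HK1] := smooth_sum_minor k1 kJ adm e0.
have [K2 K20 HK2] := gauss_mean_minor k1 adm e0.
have [K3 K30 HK3] := @smooth_sum_major R J k J0.
pose K : R := 2 * (4 * K1 + 2 * K2 + K3 * 2 ^+ J) + pi.
exists K.
  by rewrite addr_ge0 ?pi_ge0// mulr_ge0// !addr_ge0// mulr_ge0// exprn_ge0.
move=> N u alpha a q X B u0 uN q0 aq qle beta1 beta2.
have N0 : (0 < N)%N by exact: leq_trans uN.
have N1 : 1 <= N%:R :> R by rewrite ler1n.
have N0' : 0 < N%:R :> R by rewrite ltr0n.
have u0' : 0 < u%:R :> R by rewrite ltr0n.
have k0' : 0 < k%:R :> R by rewrite ltr0n.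
have k1' : 1 <= k%:R :> R by rewrite ler1n.
have q0' : 0 < q%:R :> R by rewrite ltr0n.
have q1' : 1 <= q%:R :> R by rewrite ler1n.
have [Y0 Yu uY u2Y YX] := scaleP R k0 u0 (ltnW uN).
set Y := scale R k N u in Y0 Yu uY u2Y YX *.
have dist2 := beta2; set beta := alpha - _ in beta1 beta2 *.
have YE : Y = (fine_mesh k N)%:R / (scale_den R k N u)%:R by [].
have alphaE : alpha = a%:~R / q%:R + beta by rewrite addrC subrK.
rewrite -/X in YX.
clearbody Y beta.
have X1 : 1 <= X by rewrite -[leLHS](powRr0 N%:R) ler_powR// invr_ge0 ltW.
have X0 : 0 < X by exact: lt_le_trans X1.
have XkN : X ^+ k = N%:R.
  by rewrite -powR_mulrn ?powR_ge0// -powRrM mulVf ?gt_eqF// powRr1 ?ltW.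
have Xke : X `^ k%:R = X ^+ k by rewrite powR_mulrn ?ltW.
clearbody X.
have B0 : 0 < B by rewrite powR_gt0.
have XB1 : X^-1 <= B.
  rewrite -powR_inv1 ?(ltW X0)// /B ler_powR//.
  have : 0 <= k.+1%:R * e by rewrite mulr_ge0// ltW.
  lra.
have NB : N%:R^-1 <= B.
  apply: le_trans XB1; rewrite -XkN lef_pV2 ?posrE ?exprn_gt0//.
  by rewrite -{1}[X]expr1 ler_weXn2l.
have Nu1 : 1 <= N%:R / u%:R :> R.
  by rewrite ler_pdivlMr// mul1r ler_nat ltnW.
have r0 : 0 < (Y / X) ^+ k by rewrite exprn_gt0// divr_gt0.
have r1 : (Y / X) ^+ k <= 1.
  by apply: exprn_ile1; [rewrite divr_ge0 ?ltW | rewrite ler_pdivrMr// mul1r].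
have unscale z c : 0 <= c -> (Y / X) ^+ k * z <= c * B ->
    z <= 2 * c * (N%:R / u%:R * B).
  move=> c0 H; have : z <= c * B / (Y / X) ^+ k by rewrite ler_pdivlMr// mulrC.
  move=> H1; apply: le_trans H1 _; rewrite ler_pdivrMr//.
  rewrite expr_div_n XkN.
  rewrite [leRHS](_ : _ = c * B * (2 * Y ^+ k / u%:R)); last first.
    by field; rewrite !gt_eqF.
  by rewrite ler_peMr ?mulr_ge0 ?(ltW B0)// ler_pdivlMr// mul1r.
pose ue := X `^ (- (1 - e)).
have ueE : ue = X `^ (- (1 - e)) by [].
have ue0 : 0 <= ue by exact: powR_ge0.
have ue_s : ue `^ sigma = X `^ (- sigma + sigma * e).
  by rewrite /ue -powRrM; congr (_ `^ _); ring.
have se : sigma * e <= e by exact: ler_piMl (ltW e0) s1.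
have kB t : t <= k%:R * e -> X `^ t * ue `^ sigma <= B.
  move=> tk; rewrite ue_s -powRD_gt0// ler_powR// -natr1; lra.
clearbody ue B.
have s01 : 0 <= sigma <= 1 by rewrite (ltW s0).
have V1 : cabs (gauss_mean R k a q) <= 1 by exact: gauss_mean_le1.
have M0 : (0 < fine_mesh k N)%N by exact: fine_mesh_gt0.
have I1 x : cabs (grid_integral J k (fine_mesh k N) x : R[i]) <= 1.
  exact: grid_integral_le1.
have [minor|major] := leP (Y `^ (1 - e)) q%:R.
  have qX : q%:R / X ^+ k <= 2 * ue.
    rewrite ler_pdivrMr ?exprn_gt0// -mulrA -Xke ueE -powRD_gt0//.
    by rewrite (_ : - (1 - e) + k%:R = k%:R - 1 + e)//; ring.
  have := minor_factor k0 e01 q0 X1 Y0 YX minor; rewrite -ueE => /(_ qX)[F1 F2].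
  have Ssmall : cabs (smooth_sum J k Y alpha) <=
      K1 * (2 * 4 * (N%:R / u%:R * B)).
    apply: le_trans (HK1 Y alpha a q Y0 q0 aq dist2) _; rewrite ler_wpM2l//.
    apply: unscale => //; rewrite mulrCA.
    have W0 := weyl_factor_ge0 k q Y0.
    apply: (@le_trans _ _ (X `^ e * (4 * ue `^ sigma))).
      apply: ler_pM; rewrite ?powR_ge0 ?mulr_ge0 ?powR_ge0 ?(ltW r0)//.
        exact: powR_mono (ltW e0) (ltW Y0) YX.
      apply: le_trans (scale_powR_le s01 r0 r1 W0) _.
      apply: (@le_trans _ _ ((4 * ue) `^ sigma)).
        exact: powR_mono (ltW s0) (mulr_ge0 (ltW r0) W0) F2.
      by rewrite powRM// ler_wpM2r ?powR_ge0// ler1_powR// ler1n.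
    rewrite mulrCA ler_wpM2l// kB// ler_peMl// ltW//.
  have Vsmall : cabs (gauss_mean R k a q) <= K2 * (2 * 2 * (N%:R / u%:R * B)).
    apply: le_trans (HK2 a q q0 aq) _; rewrite ler_wpM2l//.
    apply: unscale => //; rewrite mulrCA.
    apply: (@le_trans _ _ (2 * X `^ (k%:R * e) * ue `^ sigma)).
      apply: ler_pM; rewrite ?powR_ge0 ?mulr_ge0 ?powR_ge0 ?(ltW r0)//.
        apply: (@le_trans _ _ ((2 * X `^ k%:R) `^ e)).
          apply: powR_mono (ltW e0) (ltW q0') _.
          apply: le_trans qle _; rewrite ler_wpM2l// ler_powR//; lra.
        rewrite powRM ?powR_ge0// -powRrM ler_wpM2r ?powR_ge0//.
        by apply: ler1_powR; [rewrite ler1n|exact: ltW].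
      apply: le_trans (scale_powR_le s01 r0 r1 _) _; first by rewrite invr_ge0.
      apply: powR_mono (ltW s0) _ F1; exact: divr_ge0 (ltW r0) (ltW q0').
    by rewrite -mulrA ler_wpM2l// kB.
  apply: le_trans (cabsB _ _) _; rewrite cabsM.
  have NuB : 0 <= N%:R / u%:R * B by rewrite mulr_ge0 ?divr_ge0// ltW.
  have VI : cabs (gauss_mean R k a q) * cabs (grid_integral J k (fine_mesh k N)
      (beta * u%:R) : R[i]) <= K2 * (2 * 2 * (N%:R / u%:R * B)).
    by apply: le_trans Vsmall; rewrite ler_piMr ?cabs_ge0.
  apply: le_trans (lerD Ssmall VI) _.
  rewrite -subr_ge0 [X in 0 <= X](_ : _ =
    (2 * (K3 * 2 ^+ J) + pi) * (N%:R / u%:R * B)); last by rewrite /K; ring.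
  by rewrite mulr_ge0// addr_ge0 ?pi_ge0// mulr_ge0// mulr_ge0// exprn_ge0.
have Y1 : 1 <= Y.
  rewrite leNgt; apply/negP => Y1; have : Y `^ (1 - e) <= 1 `^ (1 - e).
    apply: powR_mono (ltW Y0) (ltW Y1); by rewrite subr_ge0 ltW.
  by rewrite powR1 leNgt (le_lt_trans q1' major).
have XQ0 : 0 < X `^ (k%:R - 1 + e) by rewrite powR_gt0.
set z := (1 + `|beta * Y ^+ k|) * q%:R / Y.
have z0 : 0 <= z by rewrite divr_ge0 ?(ltW Y0)// mulr_ge0// addr_ge0.
have zle : z <= 2 * Y `^ (- e).
  have YYe : Y `^ (- e) * Y = Y `^ (1 - e).
    by rewrite -{2}[Y]powRr1 ?(ltW Y0)// -powRD_gt0// addrC.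
  rewrite /z ler_pdivrMr// -mulrA YYe mulrDl mul1r mulr_natl mulr2n.
  apply: lerD; first exact: ltW.
  rewrite normrM (ger0_norm (exprn_ge0 k (ltW Y0))) mulrAC.
  apply: (@le_trans _ _ ((X `^ (k%:R - 1 + e))^-1 * Y ^+ k)).
    rewrite ler_wpM2r ?exprn_ge0 ?(ltW Y0)//.
    apply: (@le_trans _ _ ((q%:R * X `^ (k%:R - 1 + e))^-1 * q%:R)).
      by rewrite ler_wpM2r.
    by rewrite invfM mulrAC mulVf ?gt_eqF// mul1r.
  rewrite mulrC ler_pdivrMr// -powR_mulrn ?(ltW Y0)//.
  rewrite [X in Y `^ X <= _](_ : _ = (1 - e) + (k%:R - 1 + e)); last by ring.
  rewrite powRD_gt0// ler_wpM2l ?powR_ge0//.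
  by apply: powR_mono (ltW Y0) YX; rewrite addr_ge0 ?subr_ge0// ltW.
have zJ : z ^+ J <= 2 ^+ J * Y^-1.
  apply: (@le_trans _ _ ((2 * Y `^ (- e)) ^+ J)).
    by rewrite lerXn2r ?nnegrE// mulr_ge0 ?powR_ge0.
  rewrite exprMn ler_wpM2l ?exprn_ge0// -powR_mulrn ?powR_ge0// -powRrM.
  by rewrite -powR_inv1 ?(ltW Y0)// ler_powR// mulNr lerN2 mulrC.
have Yinv : Y^-1 <= 2 * 1 * (N%:R / u%:R * B).
  apply: unscale => //; rewrite mul1r; apply: le_trans XB1.
  have i01 : 0 <= (1 : R) <= 1 by rewrite ler01 lexx.
  have := pow_scale_le k0 Y0 YX i01.
  by rewrite (powR_inv1 (ltW Y0)) (powR_inv1 (ltW X0)).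
have := HK3 (fine_mesh k N) (scale_den R k N u) a q beta Y M0 isT q0 YE.
rewrite -/z -alphaE => HS.
set V := gauss_mean R k a q in V1 HS *.
set I' := grid_integral _ _ _ _ in HS.
set I := grid_integral _ _ _ _.
have -> : smooth_sum J k Y alpha - V * I =
  (smooth_sum J k Y alpha - V * I') + V * (I' - I) by ring.
apply: le_trans (cabsD _ _) _; rewrite cabsM.
have HI : cabs V * cabs (I' - I) <= pi * (N%:R / u%:R * B).
  apply: (@le_trans _ _ (cabs (I' - I))); first by rewrite ler_piMl ?cabs_ge0.
  apply: le_trans (grid_integral_lipschitz _ _ _ _ M0) _.
  have b1 : `|beta| <= 1.
    apply: le_trans beta2 _; rewrite invf_le1 ?exprn_gt0//.
    by rewrite exprn_ege1.
  rewrite -mulrBr normrM distrC (@ger0_norm _ (u%:R - Y ^+ k)) ?subr_ge0//.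
  apply: (@le_trans _ _ (2 * pi * (1 * (2 * N%:R)^-1))).
    rewrite ler_wpM2l ?mulr_ge0 ?pi_ge0// ler_pM ?subr_ge0//.
  rewrite [leLHS](_ : _ = pi * N%:R^-1); last by field; rewrite gt_eqF.
  rewrite ler_wpM2l ?pi_ge0//; apply: le_trans NB _.
  by rewrite ler_peMl// ltW.
have HS' : cabs (smooth_sum J k Y alpha - V * I') <=
    K3 * (2 ^+ J * (2 * 1 * (N%:R / u%:R * B))).
  apply: le_trans HS _; rewrite ler_wpM2l//; apply: le_trans zJ _.
  by rewrite ler_wpM2l// exprn_ge0.
apply: le_trans (lerD HS' HI) _.
rewrite -subr_ge0 [X in 0 <= X](_ : _ =
  2 * (4 * K1 + 2 * K2) * (N%:R / u%:R * B)); last by rewrite /K; ring.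
rewrite mulr_ge0//; last by rewrite mulr_ge0 ?divr_ge0// ltW.
by rewrite mulr_ge0// addr_ge0// mulr_ge0.
Qed.

End LowerBound.

Section VanDerCorput.
Variable R : realType.
Implicit Types (J k s N M u q : nat) (a : int) (X Y alpha beta sigma e : R).

(** The weights [N - u] are those of Fejer's kernel, in the variable [u], the
  [k]-th power of the scale. *)
Definition vdc_poly J k s N alpha : R[i] :=
  \sum_(1 <= u < N) ((N - u)%:R)%:C * smooth_sum J k (scale R k N u) alpha ^+ s.

Lemma harmonic_le N : (0 < N)%N ->
  \sum_(1 <= u < N) u%:R^-1 <= 1 + ln (N%:R : R).
Proof.
move=> N0; apply: (@le_trans _ _ (\sum_(1 <= u < N.+1) u%:R^-1)).
  by rewrite big_nat_recr//= lerDl invr_ge0.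
case: N N0 => // N _; elim: N => [|N IH].
  by rewrite big_nat1 invr1 ln1 addr0.
rewrite big_nat_recr//=.
have n1 : 0 < N.+1%:R :> R by rewrite ltr0n.
have n2 : 0 < N.+2%:R :> R by rewrite ltr0n.
have : ln (1 + - N.+2%:R^-1 : R) <= - N.+2%:R^-1.
  by apply: le_ln1Dx; rewrite ltrN2 invf_lt1// ltr1n.
have -> : 1 + - N.+2%:R^-1 = N.+1%:R / N.+2%:R :> R.
  by rewrite -(natr1 N.+1) in n2 *; field; rewrite gt_eqF.
rewrite ln_div ?posrE//; move: IH.
move: (ln N.+1%:R) (ln N.+2%:R) (N.+2%:R^-1) (\sum_(1 <= u < N.+2) _).
by move=> x y z S; lra.
Qed.

(** The complete sums are real and [s] is even, so that the main term on every
  arc is a nonnegative multiple of a quantity controlled by Fejer's kernel. *)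
Lemma vdc_poly_lower J k s sigma e : (1 < k)%N -> odd k -> ~~ odd s ->
  (k <= J)%N -> weyl_admissible k sigma -> 0 < e < 1 -> 1 <= J%:R * e ->
  exists2 K, 0 <= K & forall N alpha, (0 < N)%N ->
    - (K * (N%:R ^+ 2 * (N%:R `^ (k%:R^-1)) `^ (- sigma + k.+1%:R * e) *
         (2 + ln N%:R))) <= complex.Re (vdc_poly J k s N alpha).
Proof.
move=> k1 k_odd s_even kJ adm e01 Je; have [e0 e1] := andP e01.
have k0 : (0 < k)%N by exact: ltnW.
have k1' : 1 <= k%:R :> R by rewrite ler1n.
have s1 := weyl_admissible_le1 k1 adm.
have [K K0 HK] := local_approx k1 kJ adm e01 Je.
exists (s%:R * K + 1); first by rewrite addr_ge0// mulr_ge0.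
move=> N alpha N0; set X := N%:R `^ _; set B := X `^ _.
have N1 : 1 <= N%:R :> R by rewrite ler1n.
have N0' : 0 < N%:R :> R by rewrite ltr0n.
have X1 : 1 <= X.
  by rewrite -[leLHS](powRr0 N%:R) ler_powR// invr_ge0 (le_trans ler01).
have X0 : 0 < X by exact: lt_le_trans X1.
have B0 : 0 <= B by exact: powR_ge0.
have XkN : X ^+ k = N%:R.
  rewrite -powR_mulrn ?powR_ge0// -powRrM mulVf ?powRr1// gt_eqF//.
  exact: lt_le_trans k1'.
have NB : N%:R^-1 <= B.
  rewrite -XkN -powR_invn ?(ltW X0)// ler_powR//.
  have : 0 <= k.+1%:R * e by rewrite mulr_ge0// ltW.
  lra.
(* The extra [e] makes the arcs so short that [q |beta| Y ^ (k - 1)] is at most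
  [Y ^ (- e)], at the price of denominators slightly above [X ^ (k - 1)]. *)
pose x := X `^ (k%:R - 1 + e).
have x1 : 1 <= x.
  by rewrite -[leLHS](powRr0 X) ler_powR// addr_ge0 ?subr_ge0// ltW.
have x0 : 0 < x by exact: lt_le_trans x1.
pose Q := (Num.truncn x).+1.
have xQ : x <= Q%:R by rewrite ltW//; have /andP[] := truncn_itv (ltW x0).
have Qx : Q%:R <= 2 * x.
  rewrite mulr_natl mulr2n /Q -(natr1 (Num.truncn x)); apply: lerD => //.
  by rewrite truncn_le ltW.
have [a [q [q0 qQ aq Hd]]] := dirichlet_approx alpha (ltn0Sn (Num.truncn x)).
rewrite -/Q in qQ Hd.
have q0' : 0 < q%:R :> R by rewrite ltr0n.
have qQ' : q%:R <= Q%:R :> R by rewrite ler_nat.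
have d1 : `|alpha - a%:~R / q%:R| <= (q%:R * x)^-1.
  by apply: le_trans Hd _; rewrite lef_pV2 ?posrE ?mulr_gt0// ler_pM2l.
have d2 : `|alpha - a%:~R / q%:R| <= (q%:R ^+ 2)^-1.
  apply: le_trans Hd _; rewrite lef_pV2 ?posrE ?mulr_gt0 ?exprn_gt0//.
  by rewrite expr2 ler_pM2l.
have qx : q%:R <= 2 * x by exact: le_trans Qx.
set beta := alpha - a%:~R / q%:R.
pose S u := smooth_sum J k (scale R k N u) alpha.
pose I u := grid_integral J k (fine_mesh k N) (beta * u%:R) : R[i].
pose V := gauss_mean R k a q.
have M0 := fine_mesh_gt0 k0 N0.
have V1 : cabs V <= 1 by exact: gauss_mean_le1.
have I1 u : cabs (I u) <= 1 by exact: grid_integral_le1.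
pose v := complex.Re V.
have VE : V = v%:C by exact: gauss_mean_real.
have v1 : `|v| <= 1 by apply: le_trans V1; exact: ler_Re_cabs.
have vs0 : 0 <= v ^+ s by rewrite exprn_even_ge0.
have vs1 : v ^+ s <= 1.
  by rewrite (le_trans (ler_norm _))// normrX exprn_ile1.
have term u : (0 < u)%N -> (u < N)%N ->
    v ^+ s * complex.Re (I u ^+ s) - s%:R * K * (N%:R / u%:R * B) <=
    complex.Re (S u ^+ s).
  move=> u0 uN; have [Y0 _ _ _ _] := scaleP R k0 u0 (ltnW uN).
  have H := HK N u alpha a q u0 uN q0 aq qx d1 d2.
  have E : complex.Re ((V * I u) ^+ s) = v ^+ s * complex.Re (I u ^+ s).
    rewrite exprMn VE -Re_realM; congr (complex.Re (_ * _)).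
    exact/esym/(rmorphXn (real_complex R)).
  rewrite -E lerBlDr -lerBlDl.
  have -> : complex.Re ((V * I u) ^+ s) - complex.Re (S u ^+ s) =
      - complex.Re (S u ^+ s - (V * I u) ^+ s).
    by case: (S u ^+ s) => ? ?; case: ((V * I u) ^+ s) => ? ?; rewrite /= opprB.
  apply: le_trans (ler_norm _) _; rewrite normrN.
  apply: le_trans (ler_Re_cabs _) _.
  have VI1 : cabs (V * I u) <= 1 by rewrite cabsM mulr_ile1 ?cabs_ge0.
  apply: le_trans (cabs_subX s (smooth_sum_le1 J k alpha Y0) VI1) _.
  by rewrite -mulrA ler_wpM2l.
have H1 : complex.Re (vdc_poly J k s N alpha) =
    \sum_(1 <= u < N) (N - u)%:R * complex.Re (S u ^+ s).
  by rewrite /vdc_poly Re_sum; apply: eq_bigr => u _; rewrite Re_realM.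
have H2 : \sum_(1 <= u < N) (N - u)%:R *
    (v ^+ s * complex.Re (I u ^+ s) - s%:R * K * (N%:R / u%:R * B)) <=
    complex.Re (vdc_poly J k s N alpha).
  rewrite H1; apply: ler_sum_nat => u /andP[u0 uN].
  by rewrite ler_wpM2l// term.
apply: le_trans H2.
have -> : \sum_(1 <= u < N) (N - u)%:R *
    (v ^+ s * complex.Re (I u ^+ s) - s%:R * K * (N%:R / u%:R * B)) =
  v ^+ s * (\sum_(1 <= u < N) (N - u)%:R * complex.Re (I u ^+ s)) -
  s%:R * K * B * N%:R * (\sum_(1 <= u < N) (N - u)%:R * u%:R^-1).
  rewrite !mulr_sumr -sumrB; apply: eq_bigr => u _; ring.
have HF := grid_integral_fejer J k s N beta M0.
have HF' : - (N%:R / 2) <=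
    v ^+ s * (\sum_(1 <= u < N) (N - u)%:R * complex.Re (I u ^+ s)).
  apply: (@le_trans _ _ (v ^+ s * - (N%:R / 2))).
    by rewrite mulrN lerN2 ler_piMl// divr_ge0.
  by rewrite ler_wpM2l.
have HH : \sum_(1 <= u < N) (N - u)%:R * u%:R^-1 <= N%:R * (1 + ln N%:R) :> R.
  apply: (@le_trans _ _ (N%:R * \sum_(1 <= u < N) u%:R^-1)).
    rewrite mulr_sumr; apply: ler_sum => u _.
    by rewrite ler_wpM2r ?invr_ge0// ler_nat leq_subr.
  by rewrite ler_wpM2l// harmonic_le.
have L0 : 0 <= ln N%:R :> R by exact: ln_ge0.
have C0 : 0 <= s%:R * K * B * N%:R by rewrite !mulr_ge0.
have HH' := ler_wpM2l C0 HH.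
have NB2 : N%:R / 2 <= N%:R ^+ 2 * B.
  apply: (@le_trans _ _ (N%:R ^+ 2 * N%:R^-1)); last first.
    by rewrite ler_wpM2l// exprn_ge0.
  rewrite [leRHS](_ : _ = N%:R); last by field; rewrite gt_eqF.
  by rewrite ler_pdivrMr// ler_peMr// ler1n.
have P1 : 0 <= N%:R ^+ 2 * B by rewrite mulr_ge0// exprn_ge0.
have P2 : 0 <= s%:R * K * (N%:R ^+ 2 * B) by rewrite mulr_ge0// mulr_ge0.
have P3 : 0 <= N%:R ^+ 2 * B * ln N%:R by rewrite mulr_ge0.
have E : (s%:R * K + 1) * (N%:R ^+ 2 * B * (2 + ln N%:R)) =
  s%:R * K * B * N%:R * (N%:R * (1 + ln N%:R)) + s%:R * K * (N%:R ^+ 2 * B) +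
  2 * (N%:R ^+ 2 * B) + N%:R ^+ 2 * B * ln N%:R by ring.
rewrite E.
clear -HF' HH' NB2 P1 P2 P3.
lra.
Qed.

Definition smooth_mass J Y : R :=
  Y^-1 * \sum_(1 <= m < (Num.truncn Y).+1) bump J (m%:R / Y).

Lemma smooth_sum0 J k Y : smooth_sum J k Y 0 = (smooth_mass J Y)%:C.
Proof.
rewrite /smooth_sum /smooth_mass rmorphM rmorph_sum; congr (_ * _).
by apply: eq_bigr => m _; rewrite mul0r expe0 mulr1.
Qed.

Lemma bump_prefix_ge0 J Y m : 0 < Y -> (m < (Num.truncn Y).+1)%N ->
  0 <= bump J (m%:R / Y).
Proof.
move=> Y0; rewrite ltnS => mY; apply: bump_ge0; rewrite divr_ge0 ?(ltW Y0)//=.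
rewrite ler_pdivrMr// mul1r (@le_trans _ _ (Num.truncn Y)%:R) ?ler_nat//.
by rewrite truncn_le ltW.
Qed.

Lemma smooth_mass_ge0 J Y : 0 < Y -> 0 <= smooth_mass J Y.
Proof.
move=> Y0; rewrite mulr_ge0 ?invr_ge0 ?(ltW Y0)// big_nat_cond.
by apply: sumr_ge0 => m /andP[/andP[_ mY] _]; exact: bump_prefix_ge0.
Qed.

(** With [b] about [Y / 3], the terms [b <= m < 2 b] have [m / Y] between
  [1 / 12] and [2 / 3], and they alone suffice. *)
Lemma smooth_mass_ge J Y : 4 <= Y -> 12%:R^-1 * (36%:R^-1) ^+ J <= smooth_mass J Y.
Proof.
move=> Y4; have Y0 : 0 < Y by exact: lt_le_trans Y4.
have Y3 : 0 <= Y / 3 by rewrite divr_ge0// ltW.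
pose b := Num.truncn (Y / 3).
have /andP[bY Yb] := truncn_itv Y3; rewrite -/b -(natr1 b) in bY Yb.
have b1 : (1 <= b)%N.
  by rewrite -(ltr0n R); lra.
have b2 : (b + b <= (Num.truncn Y).+1)%N.
  apply: leqW; rewrite -ltnS -(@ltr_nat R) natrD.
  by have /andP[_] := truncn_itv (ltW Y0); lra.
have bn : (b <= (Num.truncn Y).+1)%N by rewrite (leq_trans _ b2)// leq_addr.
have bb : (b <= b + b)%N by rewrite leq_addr.
have S1 : \sum_(b <= m < b + b) bump J (m%:R / Y) <=
    \sum_(1 <= m < (Num.truncn Y).+1) bump J (m%:R / Y).
  rewrite [leRHS](big_cat_nat b1 bn)/= [X in _ <= _ + X](big_cat_nat bb b2)/=.
  rewrite addrCA lerDl addr_ge0//; rewrite big_nat_cond; apply: sumr_ge0 => m.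
    by move=> /andP[/andP[_ mb] _]; apply: bump_prefix_ge0 => //; exact: leq_trans bn.
  by move=> /andP[/andP[_ mb] _]; exact: bump_prefix_ge0.
have S2 : \sum_(b <= m < b + b) 36%:R^-1 ^+ J <=
    \sum_(b <= m < b + b) bump J (m%:R / Y).
  apply: ler_sum_nat => m /andP[bm mb].
  rewrite /bump -exprMn lerXn2r ?nnegrE ?invr_ge0//.
    rewrite mulr_ge0 ?divr_ge0 ?(ltW Y0)// subr_ge0 ler_pdivrMr// mul1r.
    have : m%:R <= (b + b)%:R :> R by rewrite ler_nat ltnW.
    rewrite natrD; lra.
  have l1 : 12%:R^-1 <= m%:R / Y.
    rewrite ler_pdivlMr//; have : b%:R <= m%:R :> R by rewrite ler_nat.
    lra.
  have l2 : 3%:R^-1 <= 1 - m%:R / Y.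
    rewrite lerBrDr -lerBrDl ler_pdivrMr//.
    have : m%:R <= (b + b)%:R :> R by rewrite ler_nat ltnW.
    rewrite natrD; lra.
  have -> : 36%:R^-1 = 12%:R^-1 * 3%:R^-1 :> R by field.
  by apply: ler_pM; rewrite ?invr_ge0.
rewrite sumr_const_nat addnK -[leLHS]mulr_natr in S2.
have c0 : 0 <= 36%:R^-1 ^+ J :> R by rewrite exprn_ge0 ?invr_ge0.
apply: (@le_trans _ _ (Y^-1 * (36%:R^-1 ^+ J * b%:R))); last first.
  by rewrite ler_wpM2l ?invr_ge0 ?(ltW Y0)// (le_trans S2).
rewrite mulrC mulrCA ler_wpM2l// mulrC ler_pdivlMr//; lra.
Qed.

Lemma triangular_sum_ge (b n : nat) :
  n%:R ^+ 2 <= 2 * \sum_(b <= u < b + n) (b + n - u)%:R :> R.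
Proof.
elim: n => [|n IH]; first by rewrite expr0n mulr_ge0// sumr_ge0.
have -> : \sum_(b <= u < b + n.+1) (b + n.+1 - u)%:R =
    \sum_(b <= u < b + n) (b + n - u)%:R + n.+1%:R :> R.
  rewrite addnS big_nat_recr ?leq_addr//= subSnn.
  have -> : \sum_(b <= u < b + n) ((b + n).+1 - u)%:R =
      \sum_(b <= u < b + n) ((b + n - u)%:R + 1) :> R.
    apply: eq_big_nat => u /andP[_ un]; rewrite subSn ?natr1//.
    exact: ltnW.
  by rewrite big_split/= sumr_const_nat addKn -addrA natr1.
rewrite mulrDr -natr1; lra.
Qed.

Lemma vdc_poly0 J k s : (0 < k)%N -> exists c N0, 0 < c /\
  forall N, (N0 <= N)%N -> c * N%:R ^+ 2 <= complex.Re (vdc_poly J k s N 0).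
Proof.
move=> k0; pose u0 := (2 * 4 ^ k)%N.
have u00 : (0 < u0)%N by rewrite muln_gt0 expn_gt0.
pose c : R := 12%:R^-1 * 36%:R^-1 ^+ J.
have c0 : 0 < c by rewrite mulr_gt0 ?exprn_gt0 ?invr_gt0.
(* From [u0] on the scales are at least [4]. *)
exists (c ^+ s / 8), (2 * u0)%N; split; first by rewrite divr_gt0 ?exprn_gt0.
move=> N N0; have u0N : (u0 <= N)%N by lia.
have mass_ge u : (0 < u)%N -> (u < N)%N -> (u0 <= u)%N ->
    c <= smooth_mass J (scale R k N u).
  move=> u1 uN u0u; have [Y0 _ _ u2 _] := scaleP R k0 u1 (ltnW uN).
  have [Y4|Y4] := leP 4 (scale R k N u); first exact: smooth_mass_ge.
  exfalso; have : scale R k N u ^+ k < 4 ^+ k.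
    by rewrite ltrXn2r ?nnegrE ?(ltW Y0)// gtn_eqF.
  have : u0%:R <= u%:R :> R by rewrite ler_nat.
  rewrite natrM natrX; lra.
have Re_term u : (0 < u)%N -> (u < N)%N ->
    0 <= complex.Re (smooth_sum J k (scale R k N u) 0 ^+ s) /\
    ((u0 <= u)%N -> c ^+ s <= complex.Re (smooth_sum J k (scale R k N u) 0 ^+ s)).
  move=> u1 uN; have [Y0 _ _ _ _] := scaleP R k0 u1 (ltnW uN).
  have r0 := smooth_mass_ge0 J Y0.
  rewrite smooth_sum0; set r := smooth_mass _ _ in r0 *.
  have -> : r%:C ^+ s = (r ^+ s)%:C :> R[i].
    exact/esym/(rmorphXn (real_complex R)).
  split=> /=; first exact: exprn_ge0.
  by move=> /(mass_ge u u1 uN) cr; apply: lerXn2r => //; rewrite nnegrE ltW.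
rewrite /vdc_poly Re_sum.
under eq_bigr => u _ do rewrite Re_realM.
apply: (@le_trans _ _ (\sum_(u0 <= u < N) (N - u)%:R * c ^+ s)); last first.
  rewrite [leRHS](big_cat_nat u00 u0N)/=; apply: ler_wpDl.
    rewrite big_nat_cond; apply: sumr_ge0 => u; rewrite andbT => /andP[u1 uu].
    by rewrite mulr_ge0// (Re_term u u1 (leq_trans uu u0N)).1.
  apply: ler_sum_nat => u /andP[uu uN]; rewrite ler_wpM2l//.
  by apply: (Re_term u (leq_trans u00 uu) uN).2.
rewrite -mulr_suml [leRHS]mulrC -mulrA; apply: ler_wpM2l.
  exact: exprn_ge0 (ltW c0).
have := triangular_sum_ge u0 (N - u0); rewrite subnKC// => H.
have : N%:R / 2 <= (N - u0)%:R :> R.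
  rewrite natrB// lerBrDr; have : (2 * u0)%:R <= N%:R :> R by rewrite ler_nat.
  rewrite natrM; lra.
move=> H2; have : (N%:R / 2) ^+ 2 <= (N - u0)%:R ^+ 2 :> R.
  by rewrite lerXn2r ?nnegrE// divr_ge0.
rewrite expr_div_n; lra.
Qed.

End VanDerCorput.

(** * From trigonometric polynomials to sets *)

Section Sets.
Variable R : realType.
Implicit Types (J k s N M : nat) (alpha Y E : R) (A : seq nat).

Definition exp_set A alpha : R[i] := \sum_(x <- A) expe (alpha * x%:R).

Lemma mul_conjc (z : R[i]) : z * z^*%C = (cabs z ^+ 2)%:C.
Proof.
case: z => a b; rewrite /ComplexField.Normc.normc /= sqr_sqrtr ?addr_ge0 ?sqr_ge0//.
by congr Complex; ring.
Qed.

Lemma exp_set_sqr A alpha : (cabs (exp_set A alpha) ^+ 2)%:C =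
  \sum_(x <- A) \sum_(y <- A) expe (alpha * (x%:Z - y%:Z)%:~R).
Proof.
rewrite -mul_conjc.
have -> : (exp_set A alpha)^*%C = \sum_(y <- A) expe (- (alpha * y%:R)).
  transitivity (\sum_(y <- A) (expe (alpha * y%:R))^*%C); first exact: rmorph_sum.
  by apply: eq_bigr => y _; rewrite expe_conj.
rewrite mulr_suml; apply: eq_bigr => x _; rewrite mulr_sumr; apply: eq_bigr => y _.
by rewrite -expeD -mulrBr rmorphB.
Qed.

(** Parseval's identity; [N <= M] keeps the elements of [A] distinct modulo [M].
  *)
Lemma sum_exp_set A M N : (0 < M)%N -> (N <= M)%N -> uniq A ->
  (forall x, x \in A -> (1 <= x <= N)%N) ->
  \sum_(0 <= r < M) cabs (exp_set A (r%:R / M%:R)) ^+ 2 = M%:R * (size A)%:R.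
Proof.
move=> M0 NM uA AN; apply: complexI.
have -> : (\sum_(0 <= r < M) cabs (exp_set A (r%:R / M%:R)) ^+ 2)%:C =
    \sum_(0 <= r < M) (cabs (exp_set A (r%:R / M%:R)) ^+ 2)%:C.
  exact: (rmorph_sum (real_complex R)).
under eq_bigr => r _ do rewrite exp_set_sqr.
rewrite exchange_big/=.
have -> : \sum_(x <- A) \sum_(0 <= r < M) \sum_(y <- A)
     expe (r%:R / M%:R * (x%:Z - y%:Z)%:~R : R) = \sum_(x <- A) (M%:R)%:C.
  rewrite big_seq [RHS]big_seq; apply: eq_bigr => x xA; rewrite exchange_big/=.
  rewrite (bigD1_seq x)//= [X in _ + X]big1_seq ?addr0.
    under eq_bigr => r _ do rewrite subrr mulr0 expe0.
    by rewrite sumr_const_nat subn0 -(rmorph_nat (real_complex R)).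
  move=> y /andP[yx yA]; apply: expe_orthogonality => //.
  have := AN x xA; have := AN y yA => Hy Hx.
  apply/negP => /dvdzP[h hE].
  have h0 : h = 0 by move: yx; nia.
  by move: yx; rewrite h0 mul0r in hE; lia.
rewrite big_const_seq count_predT iter_addr_0 mulr_natr.
exact/esym/(rmorphMn (real_complex R)).
Qed.

(** The modulus [(s + 1) N] exceeds every [|x - y + n|] with [x], [y] in [A] and
  [n] a sum of [s] powers of integers up to [Y], so a congruence
  [x - y + n = 0] would be an equality and exhibit [n] as a difference. *)
Lemma exp_set_smooth_sum A J k s N Y : 0 < Y -> Y ^+ k <= N%:R ->
  (0 < N)%N ->
  (forall x, x \in A -> (1 <= x <= N)%N) ->
  (forall x y (m : 'I_s -> nat), x \in A -> y \in A -> (forall i, 0 < m i)%N ->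
    x%:Z - y%:Z <> (\sum_(i < s) m i ^ k)%N%:Z) ->
  \sum_(0 <= r < s.+1 * N)
    (cabs (exp_set A (r%:R / (s.+1 * N)%:R)) ^+ 2)%:C *
    smooth_sum J k Y (r%:R / (s.+1 * N)%:R) ^+ s = 0.
Proof.
move=> Y0 YN N0 AN Adiff; set M := (s.+1 * N)%N.
have M0 : (0 < M)%N by rewrite muln_gt0.
pose n := Num.truncn Y.
pose w (l : 'I_n) : R := Y^-1 * bump J (l.+1%:R / Y).
pose t (l : 'I_n) : R := l.+1%:R ^+ k.
have SE alpha : smooth_sum J k Y alpha = \sum_(l < n) (w l)%:C * expe (alpha * t l).
  rewrite /smooth_sum big_add1/= big_mkord mulr_sumr; apply: eq_bigr => l _.
  rewrite mulrA; congr (_ * _); exact/esym/(rmorphM (real_complex R)).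
under eq_bigr => r _ do rewrite SE exp_sum_power mulr_sumr.
rewrite exchange_big/= big1// => f _.
under eq_bigr => r _ do rewrite mulrCA.
rewrite -mulr_sumr.
have -> : \sum_(0 <= r < M) (cabs (exp_set A (r%:R / M%:R)) ^+ 2)%:C *
    expe (r%:R / M%:R * \sum_i t (f i)) = 0; last by rewrite mulr0.
pose nf := (\sum_(i < s) (f i).+1 ^ k)%N.
have nfE : \sum_i t (f i) = (nf%:Z)%:~R.
  rewrite -[RHS]/(nf%:R) /nf natr_sum; apply: eq_bigr => i _; by rewrite natrX.
have nfN : (nf <= s * N)%N.
  rewrite /nf -[X in (_ <= X * _)%N]card_ord -sum_nat_const; apply: leq_sum => i _.
  rewrite -(@ler_nat R) natrX; apply: le_trans YN; rewrite lerXn2r ?nnegrE ?(ltW Y0)//.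
  apply: (@le_trans _ _ n%:R); first by rewrite ler_nat.
  by rewrite truncn_le ltW.
under eq_bigr => r _ do rewrite exp_set_sqr mulr_suml.
rewrite exchange_big/= big1_seq// => x /andP[_ xA].
under eq_bigr => r _ do rewrite mulr_suml.
rewrite exchange_big/= big1_seq// => y /andP[_ yA].
under eq_bigr => r _ do rewrite -expeD -mulrDr nfE -rmorphD.
apply: expe_orthogonality => //.
have h_neq0 : x%:Z - y%:Z + nf%:Z <> 0.
  have := Adiff y x (fun i => (f i).+1) yA xA (fun i => isT); rewrite -/nf.
  by lia.
have := AN x xA; have := AN y yA => Hy Hx.
have h_gt0 : (0 < absz (x%:Z - y%:Z + nf%:Z)%R)%N by rewrite absz_gt0; apply/eqP.
apply/negP; rewrite dvdzE absz_nat => /(dvdn_leq h_gt0).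
rewrite /M mulSn; move: (s * N)%N nfN => sN nfN.
by lia.
Qed.

(** The frequency [0] contributes [|A| ^ 2 T(0)] to a vanishing sum, and by
  Parseval the others contribute at least [- E M |A|]. *)
Lemma vdc_set_bound A J k s N E : (0 < k)%N -> (0 < N)%N -> uniq A -> 0 <= E ->
  (forall x, x \in A -> (1 <= x <= N)%N) ->
  (forall x y (m : 'I_s -> nat), x \in A -> y \in A -> (forall i, 0 < m i)%N ->
    x%:Z - y%:Z <> (\sum_(i < s) m i ^ k)%N%:Z) ->
  (forall alpha, - E <= complex.Re (vdc_poly J k s N alpha)) ->
  (size A)%:R * complex.Re (vdc_poly J k s N 0) <= E * (s.+1 * N)%:R.
Proof.
move=> k0 N0 uA E0 AN Adiff lower; set M := (s.+1 * N)%N.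
have M0 : (0 < M)%N by rewrite muln_gt0.
pose g r : R := cabs (exp_set A (r%:R / M%:R)) ^+ 2.
pose T r : R := complex.Re (vdc_poly J k s N (r%:R / M%:R)).
have gT : \sum_(0 <= r < M) g r * T r = 0.
  have -> : \sum_(0 <= r < M) g r * T r =
      complex.Re (\sum_(0 <= r < M) (g r)%:C * vdc_poly J k s N (r%:R / M%:R)).
    by rewrite Re_sum; apply: eq_bigr => r _; rewrite Re_realM.
  rewrite /vdc_poly; under eq_bigr => r _ do rewrite mulr_sumr.
  rewrite exchange_big/= big_nat_cond big1// => u /andP[/andP[u0 uN] _].
  under eq_bigr => r _ do rewrite mulrCA.
  have [Y0 Yu _ _ _] := scaleP R k0 u0 (ltnW uN).
  rewrite -mulr_sumr exp_set_smooth_sum ?mulr0//.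
  by apply: le_trans Yu _; rewrite ler_nat ltnW.
have g0 r : 0 <= g r by exact: sqr_ge0.
have sum_g : \sum_(0 <= r < M) g r = M%:R * (size A)%:R.
  by apply: (@sum_exp_set A M N) => //; rewrite leq_pmull.
have gz : g 0%N = (size A)%:R ^+ 2.
  rewrite /g /exp_set; congr (_ ^+ 2).
  under eq_bigr => x _ do rewrite mul0r mul0r expe0.
  rewrite big_const_seq count_predT iter_addr_0 -[1 *+ _]/(_%:R).
  by rewrite -(rmorph_nat (real_complex R)) cabs_real normr_nat.
have Tz : T 0%N = complex.Re (vdc_poly J k s N 0) by rewrite /T mul0r.
have key : g 0%N * T 0%N <= E * (M%:R * (size A)%:R).
  move: gT; rewrite big_ltn// => /eqP; rewrite addr_eq0 => /eqP ->.
  rewrite -sumrN -sum_g mulr_sumr [leRHS]big_ltn//.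
  apply: (@le_trans _ _ (\sum_(1 <= r < M) E * g r)); last first.
    by rewrite lerDr mulr_ge0.
  by apply: ler_sum => r _; rewrite -mulrN mulrC ler_wpM2r// lerNl; exact: lower.
rewrite gz Tz in key.
have [A0|A0] := posnP (size A).
  by rewrite A0 mul0r mulr_ge0.
have A0' : 0 < (size A)%:R :> R by rewrite ltr0n.
rewrite -(ler_pM2l A0'); apply: le_trans (le_trans key _).
  by rewrite expr2 mulrA.
by rewrite le_eqVlt; apply/orP; left; apply/eqP; ring.
Qed.

Lemma log_le_powR (e x : R) : 0 < e -> 1 <= x -> 2 + ln x <= (2 + e^-1) * x `^ e.
Proof.
move=> e0 x1; have x0 : 0 < x by exact: lt_le_trans x1.
have xe1 : 1 <= x `^ e by rewrite -[leLHS](powRr0 x) ler_powR// ltW.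
have : e * ln x < x `^ e by rewrite -ln_powR ln_sublinear// powR_gt0.
move=> H; rewrite mulrDl; apply: lerD; first by rewrite ler_peMr.
by rewrite mulrC ler_pdivlMr// mulrC ltW.
Qed.

End Sets.

Local Close Scope complex_scope.

Theorem mainTheorem4 (R : realType) (k s : nat) (sigma : R)
    (k_gt1 : (1 < k)%N) (k_odd : odd k)
    (s_gt0 : (0 < s)%N) (s_even : ~~ odd s)
    (sigma_adm : weyl_admissible k sigma)
    (eps : R) (eps_gt0 : 0 < eps) :
  exists C : R, 0 < C /\
    forall (N : nat) (A : {fset nat}),
      (0 < N)%N ->
      (forall x : nat, x \in A -> (1 <= x <= N)%N) ->
      difference_set A `&` power_sums k s = set0 ->
      (#|` A|)%fset%:R <= C * N%:R `^ (1 - sigma / k%:R + eps).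
Proof.
have k0 : (0 < k)%N by exact: ltnW.
have k0' : 0 < k%:R :> R by rewrite ltr0n.
have k1' : 1 <= k%:R :> R by rewrite ler1n.
have s1 := weyl_admissible_le1 k_gt1 sigma_adm.
have sk1 : sigma / k%:R <= 1.
  by rewrite ler_pdivrMr// mul1r (le_trans s1).
(* The exponent loses [(k + 1) e / k <= 2 e] in the lower bound for [T] and [e]
   in the logarithm. *)
pose e : R := Num.min (eps / 3) 2^-1.
have e0 : 0 < e by rewrite lt_min divr_gt0//= invr_gt0.
have e2 : e <= 2^-1 by rewrite ge_min lexx orbT.
have e1 : e < 1 by apply: le_lt_trans e2 _; lra.
have e3 : 3 * e <= eps.
  have : e <= eps / 3 by rewrite ge_min lexx.
  by lra.
have e01 : 0 < e < 1 by rewrite e0.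
pose J := (k + Num.truncn (e^-1)).+1.
have kJ : (k <= J)%N by rewrite /J -addnS leq_addr.
have Je : 1 <= J%:R * e.
  rewrite -ler_pdivrMr// mul1r.
  have ei0 : 0 <= e^-1 by rewrite invr_ge0 ltW.
  have /andP[_ h] := truncn_itv ei0; rewrite ltW// (lt_le_trans h)// ler_nat.
  by rewrite /J ltnS leq_addl.
have [K K0 lower] := vdc_poly_lower k_gt1 k_odd s_even kJ sigma_adm e01 Je.
have [c [N0 [c0 mass]]] := @vdc_poly0 R J k s k0.
pose C := K * (2 + e^-1) * s.+1%:R / c.
have C0 : 0 <= C.
  by rewrite divr_ge0 ?(ltW c0)// !mulr_ge0// addr_ge0// invr_ge0 ltW.
exists (C + N0%:R + 1); split; first by rewrite ltr_wpDl// addr_ge0.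
move=> N A N_gt0 AN Adisj.
have N1 : 1 <= N%:R :> R by rewrite ler1n.
have N0' : 0 < N%:R :> R by rewrite ltr0n.
set P := N%:R `^ _.
have P1 : 1 <= P.
  rewrite -[leLHS](powRr0 N%:R) ler_powR// addr_ge0 ?subr_ge0//; exact: ltW.
have P0 : 0 <= P by exact: le_trans P1.
have [NN0|NN0] := ltnP N N0.
  (* Here the trivial bound suffices, as the exponent of [N] is nonnegative. *)
  apply: (@le_trans _ _ (N0%:R * P)); last first.
    by rewrite ler_wpM2r// -addrA addrCA lerDl addr_ge0.
  apply: (@le_trans _ _ N0%:R); last by rewrite ler_peMr.
  rewrite ler_nat; apply: leq_trans (ltnW NN0).
  rewrite -(size_iota 1 N); apply: uniq_leq_size; first exact: fset_uniq.
  by move=> x xA; rewrite mem_iota add1n ltnS; exact: AN.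
apply: (@le_trans _ _ (C * P)); last first.
  by rewrite ler_wpM2r// -addrA lerDl addr_ge0.
have Adiff x y (m : 'I_s -> nat) : x \in enum_fset A -> y \in enum_fset A ->
    (forall i, 0 < m i)%N -> x%:Z - y%:Z <> (\sum_(i < s) m i ^ k)%N%:Z.
  move=> xA yA m0 E; have : set0 (x%:Z - y%:Z); last by [].
  rewrite -Adisj; split; first by exists x => //; exists y.
  by rewrite E; exists m.
set F := N%:R ^+ 2 * (N%:R `^ (k%:R^-1)) `^ (- sigma + k.+1%:R * e) * (2 + ln N%:R).
have F0 : 0 <= F.
  rewrite mulr_ge0 ?mulr_ge0 ?exprn_ge0 ?powR_ge0// addr_ge0//; exact: ln_ge0.
have := @vdc_set_bound R (enum_fset A) J k s N (K * F) k0 N_gt0 (fset_uniq A)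
  (mulr_ge0 K0 F0) AN Adiff (fun alpha => lower N alpha N_gt0).
move=> key.
have key2 : (size (enum_fset A))%:R * (c * N%:R ^+ 2) <= K * F * (s.+1 * N)%:R.
  by apply: le_trans key; rewrite ler_wpM2l// mass.
have cN : 0 < c * N%:R ^+ 2 by rewrite mulr_gt0// exprn_gt0.
rewrite -ler_pdivlMr// in key2; apply: le_trans key2 _.
have -> : K * F * (s.+1 * N)%:R / (c * N%:R ^+ 2) =
  K * s.+1%:R / c * (N%:R * (N%:R `^ (k%:R^-1)) `^ (- sigma + k.+1%:R * e) *
    (2 + ln N%:R)).
  rewrite /F natrM; field; by rewrite !gt_eqF.
have -> : C * P = K * s.+1%:R / c * ((2 + e^-1) * P).
  rewrite /C; ring.
apply: ler_wpM2l; first by rewrite divr_ge0 ?mulr_ge0// ltW.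
apply: (@le_trans _ _ (N%:R * (N%:R `^ (k%:R^-1)) `^ (- sigma + k.+1%:R * e) *
    ((2 + e^-1) * N%:R `^ e))).
  by rewrite ler_wpM2l ?mulr_ge0 ?powR_ge0// log_le_powR.
rewrite mulrCA; apply: ler_wpM2l; first by rewrite addr_ge0// invr_ge0 ltW.
rewrite -powRrM -{1}[N%:R]powRr1 ?(ltW N0')// -!powRD_gt0//.
rewrite ler_powR//.
have -> : 1 + k%:R^-1 * (- sigma + k.+1%:R * e) + e =
  1 - sigma / k%:R + (2 + k%:R^-1) * e.
  by rewrite -(natr1 k); field; rewrite gt_eqF.
rewrite lerD2l; apply: le_trans e3; rewrite ler_wpM2r ?(ltW e0)//.
have : k%:R^-1 <= 1 :> R by rewrite invf_le1.
by lra.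
Qed.
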